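(* For $n\ge0$ and an $(n+1)$-strand connectivity $C$ (undotted diagram), put $$a_n(C):=\sum_{D\in\mathcal{D}^e(C)}\mathrm{coef}_n(D)-[2]\,\mathrm{coef}_n(C^{\mathrm{odd}}),$$ where $\mathcal{D}^e(C)$ is the set of type $D$ diagrams with connectivity $C$ and an even number of dots, and $C^{\mathrm{odd}}$ is the unique type $D$ diagram with connectivity $C$ and exactly one dot (if $C=\mathbf 1$ there is no such diagram and the last term is $0$). Then these linear combinations satisfy the recurrence relation of the coefficients of the type $A$ Jones--Wenzl projection: for all $n\ge1$, $$a_n(C)=\sum_{i\in I(C)}\frac{[i]}{[n+1]}\,a_{n-1}(C_i),$$ where $I(C)\subseteq[1,n+1]$ is the set of positions of inner-most caps of $C$ and $C_i$ is the $n$-strand connectivity obtained from $C$ by removing the inner-most cap at position $i$.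
   Context: **Algebra.** Work over $\mathbb{C}(q)$ with $[m]=(q^m-q^{-m})/(q-q^{-1})$. $\mathrm{TL}^D_{n+1}$ is the unital algebra generated by $E_0,\dots,E_n$ with relations $E_i^2=-[2]E_i$; $E_iE_jE_i=E_i$ if $i,j$ are adjacent; $E_iE_j=E_jE_i$ if $i\neq j$ are not adjacent, where adjacency is in the graph on $\{0,\dots,n\}$ with edges $\{0,2\},\{1,2\}$ and $\{i,i+1\}$ for $2\le i\le n-1$. For $m\le n$, $\mathrm{TL}^D_{m+1}$ is the subalgebra generated by $E_0,\dots,E_m$. $Q_n\in\mathrm{TL}^D_{n+1}$ is the unique element with $Q_n\ne0$, $Q_nQ_i=Q_iQ_n=Q_n$ for $0\le i\le n$, and $E_iQ_n=Q_nE_i=0$ for $0\le i\le n$. A word (product of generators) is reduced if it is not a scalar multiple of a shorter word; the distinct elements given by reduced words form a basis. **Diagrams.** An $N$-strand connectivity is a non-crossing pairing by $N$ strands of $N$ bottom and $N$ top marked points of a rectangle. Label the bottom points $1,\dots,N$ from left to right and the top points $N+1,\dots,2N$ from right to left; the strands become non-crossing chords on $\{1,\dots,2N\}$. The identity connectivity $\mathbf 1$ has chords $\{k,2N+1-k\}$. A chord is outer if it is not nested inside another chord. A type $D$ diagram is a connectivity with some chords dotted (at most one dot per chord) such that either the number of dots is even (possibly zero) and all dotted chords are outer, or there is exactly one dot, it is on the chord containing the point $1$, and the connectivity is not $\mathbf 1$. For $i\ge1$, $E_i$ is the undotted diagram with a cap joining the $i$-th and $(i+1)$-th bottom points, a cup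 joining the $i$-th and $(i+1)$-th top points, and vertical strands elsewhere; $E_0$ has the connectivity of $E_1$ with both its cap and its cup dotted. The diagram of a reduced word is obtained by stacking (left factor on top), deleting loops carrying a single dot, and, if the resulting number of dots is odd, moving the unique dot to the chord containing the point $1$. For $n\ge1$ this identifies the basis of reduced words of $\mathrm{TL}^D_{n+1}$ with the $(n+1)$-strand type $D$ diagrams. $\mathrm{coef}_n(D)$ is the coefficient in $Q_n$ of the basis element with diagram $D$; the only $1$-strand diagram is $\mathbf 1$, with $\mathrm{coef}_0(\mathbf 1)=1$. **Inner-most caps.** For an $(n+1)$-strand connectivity, there is an inner-most cap at position $i\in[1,n+1]$ if $\{i,i+1\}$ is a chord (for $i=n+1$ this is the vertical strand joining the right-most bottom and top points). Removing it means deleting this chord and relabelling the remaining $2n$ points increasingly by $1,\dots,2n$, giving an $n$-strand connectivity. *)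

(* Defs.v *)
From HB Require Import structures.
From mathcomp Require Import all_boot all_order all_algebra.
From mathcomp Require Import generic_quotient fraction complex.
From mathcomp Require Import boolp reals.

Set Implicit Arguments.
Unset Strict Implicit.
Unset Printing Implicit Defensive.

Import GRing.Theory.

Local Open Scope ring_scope.
Local Open Scope quotient_scope.

Definition Cq (R : realType) : fieldType := {fraction {poly R[i]}}.

Definition qvar (R : realType) : Cq R := tofrac ('X : {poly R[i]}).

Definition qint (K : fieldType) (q : K) (m : nat) : K :=
  (q ^+ m - q ^- m) / (q - q^-1).

(* The edges are {0, 2} and {i, i + 1} for i >= 1. *)
Definition edgeD (i j : nat) : bool :=
  (((i == 0) && (j == 2)) || ((0 < i) && (j == i.+1)))%N.

Definition adjD (i j : nat) : bool := edgeD i j || edgeD j i.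

Definition TLD_relations (K : fieldType) (q : K) (n : nat) (A : algType K)
    (E : 'I_n.+1 -> A) : Prop :=
  [/\ forall i, E i * E i = - qint q 2 *: E i,
      forall i j : 'I_n.+1, adjD i j -> E i * E j * E i = E i
    & forall i j : 'I_n.+1, i != j -> ~~ adjD i j -> E i * E j = E j * E i].

Section PresentedAlgebra.
Variables (K : fieldType) (q : K) (n : nat).

Inductive expr : Type :=
  | Gen of 'I_n.+1
  | Zero
  | One
  | Opp of expr
  | Add of expr & expr
  | Mul of expr & expr
  | Scale of K & expr.

HB.instance Definition _ := gen_eqMixin expr.
HB.instance Definition _ := gen_choiceMixin expr.

Fixpoint eval (A : algType K) (E : 'I_n.+1 -> A) (s : expr) : A :=
  match s with
  | Gen i => E i
  | Zero => 0
  | One => 1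
  | Opp s => - eval E s
  | Add s t => eval E s + eval E t
  | Mul s t => eval E s * eval E t
  | Scale c s => c *: eval E s
  end.

(* Two expressions are identified when their equality follows from the
   relations, i.e. when it holds in every algebra satisfying them; hence the
   quotient [TLD] is the algebra presented by [TLD_relations], see [TLD_gen_rel]
   and [TLD_universal]. *)
Definition expr_eq (s t : expr) : bool :=
  `[< forall (A : algType K) (E : 'I_n.+1 -> A),
        TLD_relations q E -> eval E s = eval E t >].

Lemma expr_eqP s t :
  reflect (forall (A : algType K) (E : 'I_n.+1 -> A),
             TLD_relations q E -> eval E s = eval E t) (expr_eq s t).
Proof. exact: asboolP. Qed.

Lemma expr_eq_refl : reflexive expr_eq.
Proof. by move=> s; apply/expr_eqP. Qed.

Lemma expr_eq_sym : symmetric expr_eq.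
Proof.
by move=> s t; apply/expr_eqP/expr_eqP => h A E hE; rewrite (h A E hE).
Qed.

Lemma expr_eq_trans : transitive expr_eq.
Proof.
move=> t s u /expr_eqP st /expr_eqP tu; apply/expr_eqP => A E hE.
by rewrite (st A E hE) (tu A E hE).
Qed.

Canonical expr_eq_equiv :=
  EquivRel expr_eq expr_eq_refl expr_eq_sym expr_eq_trans.

Definition TLD : Type := {eq_quot expr_eq}.

HB.instance Definition _ : EqQuotient _ expr_eq TLD := EqQuotient.on TLD.
HB.instance Definition _ := Choice.on TLD.

Lemma TLD_eq s t : expr_eq s t -> \pi_TLD s = \pi_TLD t.
Proof. by move=> st; apply/eqmodP. Qed.

Lemma eval_repr (A : algType K) (E : 'I_n.+1 -> A) s :
  TLD_relations q E -> eval E (repr (\pi_TLD s)) = eval E s.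
Proof.
move=> hE; have /eqmodP/expr_eqP : \pi_TLD (repr (\pi_TLD s)) = \pi_TLD s.
  by rewrite reprK.
exact.
Qed.

Definition TLD_zero : TLD := \pi_TLD Zero.
Definition TLD_one : TLD := \pi_TLD One.
Definition TLD_opp (x : TLD) : TLD := \pi_TLD (Opp (repr x)).
Definition TLD_add (x y : TLD) : TLD := \pi_TLD (Add (repr x) (repr y)).
Definition TLD_mul (x y : TLD) : TLD := \pi_TLD (Mul (repr x) (repr y)).
Definition TLD_scale (c : K) (x : TLD) : TLD := \pi_TLD (Scale c (repr x)).

Local Ltac law L :=
  let hE := fresh in
  repeat intro; apply: TLD_eq; apply/expr_eqP => ? ? hE /=;
  rewrite ?(eval_repr _ hE) /= ?(eval_repr _ hE); exact: L.

Local Ltac law_at x L :=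
  rewrite -[RHS](reprK x); law L.

Lemma TLD_addA : associative TLD_add. Proof. law addrA. Qed.
Lemma TLD_addC : commutative TLD_add. Proof. law addrC. Qed.
Lemma TLD_add0 : left_id TLD_zero TLD_add.
Proof. by move=> x; law_at x add0r. Qed.
Lemma TLD_addN : left_inverse TLD_zero TLD_opp TLD_add.
Proof. law addNr. Qed.

HB.instance Definition _ :=
  GRing.isZmodule.Build TLD TLD_addA TLD_addC TLD_add0 TLD_addN.

Lemma TLD_mulA : associative TLD_mul. Proof. law mulrA. Qed.
Lemma TLD_mul1 : left_id TLD_one TLD_mul.
Proof. by move=> x; law_at x mul1r. Qed.
Lemma TLD_mulr1 : right_id TLD_one TLD_mul.
Proof. by move=> x; law_at x mulr1. Qed.
Lemma TLD_mulDl : left_distributive TLD_mul TLD_add.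
Proof. law mulrDl. Qed.
Lemma TLD_mulDr : right_distributive TLD_mul TLD_add.
Proof. law mulrDr. Qed.
Lemma TLD_one_neq0 : TLD_one != TLD_zero.
Proof.
apply/eqP => /eqmodP/expr_eqP/(_ K^o (fun=> 0)) h.
have /eqP : 1 = 0 :> K by apply: h; split=> *; rewrite ?mulr0 ?scaler0.
by rewrite oner_eq0.
Qed.

HB.instance Definition _ := GRing.Zmodule_isNzRing.Build TLD
  TLD_mulA TLD_mul1 TLD_mulr1 TLD_mulDl TLD_mulDr TLD_one_neq0.

Lemma TLD_scaleA a b x : TLD_scale a (TLD_scale b x) = TLD_scale (a * b) x.
Proof. law scalerA. Qed.
Lemma TLD_scale1 : left_id 1 TLD_scale.
Proof. by move=> x; law_at x scale1r. Qed.
Lemma TLD_scaleDr : right_distributive TLD_scale +%R.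
Proof. law scalerDr. Qed.
Lemma TLD_scaleDl x : {morph TLD_scale^~ x : a b / a + b}.
Proof. by move=> a b; law scalerDl. Qed.

HB.instance Definition _ := GRing.Zmodule_isLmodule.Build K TLD
  TLD_scaleA TLD_scale1 TLD_scaleDr TLD_scaleDl.

Lemma TLD_scaleAl (a : K) (x y : TLD) : a *: (x * y) = (a *: x) * y.
Proof. law scalerAl. Qed.

HB.instance Definition _ := GRing.Lmodule_isLalgebra.Build K TLD TLD_scaleAl.

Lemma TLD_scaleAr (a : K) (x y : TLD) : a *: (x * y) = x * (a *: y).
Proof. law scalerAr. Qed.

HB.instance Definition _ := GRing.Lalgebra_isAlgebra.Build K TLD TLD_scaleAr.

Definition gen (i : 'I_n.+1) : TLD := \pi_TLD (Gen i).

Definition TLD_lift (A : algType K) (E : 'I_n.+1 -> A) (x : TLD) : A :=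
  eval E (repr x).

Lemma TLD_gen_rel : TLD_relations q gen.
Proof.
by split=> [i|i j ij|i j ij nij]; apply: TLD_eq; apply/expr_eqP => A E hE /=;
   rewrite ?(eval_repr _ hE) /= ?(eval_repr _ hE) /=;
   case: hE => h1 h2 h3; rewrite ?h1 ?h2 ?(h3 _ _ ij).
Qed.

Lemma TLD_universal (A : algType K) (E : 'I_n.+1 -> A) (hE : TLD_relations q E) :
  [/\ forall i, TLD_lift E (gen i) = E i,
      TLD_lift E 1 = 1,
      {morph TLD_lift E : x y / x * y},
      {morph TLD_lift E : x y / x + y}
    & forall c, {morph TLD_lift E : x / c *: x}].
Proof.
by split=> [i||x y|x y|c x]; rewrite /TLD_lift (eval_repr _ hE).
Qed.

End PresentedAlgebra.

(* The canonical map identifying [TLD q m] with the subalgebra of [TLD q n]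
   generated by the first [m.+1] generators. *)
Definition TLD_incl (K : fieldType) (q : K) (m n : nat) (le_mn : (m <= n)%N) :
    TLD q m -> TLD q n :=
  TLD_lift (fun i => gen q (widen_ord (le_mn : (m.+1 <= n.+1)%N) i)).

Definition is_projection (K : fieldType) (q : K) (Q : forall n, TLD q n) : Prop :=
  forall n,
    [/\ Q n <> 0,
        forall i : 'I_n.+1, Q n * TLD_incl (leq_ord i) (Q i) = Q n /\
                            TLD_incl (leq_ord i) (Q i) * Q n = Q n
      & forall i : 'I_n.+1, gen q i * Q n = 0 /\ Q n * gen q i = 0].

Definition word_elt (K : fieldType) (q : K) (n : nat) (w : seq 'I_n.+1) : TLD q n :=
  \prod_(i <- w) gen q i.

Definition reduced (K : fieldType) (q : K) (n : nat) (w : seq 'I_n.+1) : Prop :=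
  forall (c : K) (v : seq 'I_n.+1),
    (size v < size w)%N -> word_elt q w <> c *: word_elt q v.

Local Open Scope nat_scope.

(* The marked points are numbered from 0: the element [k] of ['I_(N.*2)] is the
   point labelled [k + 1]. The bottom points are those [< N]; the top point
   above the bottom point [k] is [rev_ord k]. A pairing is encoded as the
   function sending each point to the other end of its chord. *)
Definition pairing (N : nat) := {ffun 'I_N.*2 -> 'I_N.*2}.

Definition connectivity (N : nat) (C : pairing N) : bool :=
  [forall x, (C x != x) && (C (C x) == x)]
  && [forall x : 'I_N.*2, forall y : 'I_N.*2, ~~ [&& x < y, y < C x & C x < C y]].

Definition id_pairing (N : nat) : pairing N := [ffun x => rev_ord x].

(* A chord is represented by its smaller end, and a set of dotted chords by the
   set of their smaller ends. *)
Definition chord (N : nat) (C : pairing N) (x : 'I_N.*2) : bool := x < C x.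

Definition outer (N : nat) (C : pairing N) (x : 'I_N.*2) : bool :=
  [forall y : 'I_N.*2, ~~ ((y < x) && (C x < C y))].

Definition dotted_pairing (N : nat) := (pairing N * {set 'I_N.*2})%type.

(* The chord containing the point labelled 1. *)
Definition first_chord (N : nat) : {set 'I_N.*2} := [set x : 'I_N.*2 | x == 0 :> nat].

Definition typeD (N : nat) (D : dotted_pairing N) : bool :=
  let: (C, dots) := D in
  [&& connectivity C, dots \subset chord C
    & (~~ odd #|dots| && [forall x in dots, outer C x])
      || ((dots == first_chord N) && (C != id_pairing N))].

Definition diagram (N : nat) := {D : dotted_pairing N | typeD D}.

Definition conn (N : nat) (D : diagram N) : pairing N := (val D).1.

Definition ndots (N : nat) (D : diagram N) : nat := #|(val D).2|.

(* The cap joins the points [i.-1] and [i.-1 + 1] (counted from 0), for [i = 0]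
   as for [i = 1]; the cup joins their mirror images. *)
Definition gen_pairing (n i : nat) : pairing n.+1 :=
  [ffun x : 'I_(n.+1).*2 =>
     let a := inord i.-1 in let b := inord i.-1.+1 in
     if x == a then b else if x == b then a else
     if x == rev_ord a then rev_ord b else if x == rev_ord b then rev_ord a
     else rev_ord x].

Definition gen_diagram (n i : nat) : dotted_pairing n.+1 :=
  (gen_pairing n i,
   if i == 0 then [set inord 0; rev_ord (inord 1)] else set0).

Section Stack.
Variables (N : nat) (U L : dotted_pairing N).

(* [(true, x)] is the point [x] of the upper diagram [U], and [(false, x)] the
   point [x] of the lower diagram [L]; the bottom points of [U] are glued to
   the top points of [L]. *)
Definition layer (b : bool) : dotted_pairing N := if b then U else L.

Definition link : rel (bool * 'I_N.*2) := fun u v =>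
  if u.1 == v.1 then v.2 == (layer u.1).1 u.2
  else (u.1 == (u.2 < N)) && (v.2 == rev_ord u.2).

Definition boundary (x : 'I_N.*2) : bool * 'I_N.*2 := (N <= x, x).

Definition stack_pairing : pairing N :=
  [ffun x => odflt x
     [pick y | (y != x) && connect link (boundary x) (boundary y)]].

Definition strand_dots (x : 'I_N.*2) : nat :=
  #|[set u | connect link (boundary x) u && (u.2 \in (layer u.1).2)]|.

(* Closed loops have no boundary point, so they are dropped; two dots on a
   strand cancel. *)
Definition stack : dotted_pairing N :=
  (stack_pairing,
   [set x | chord stack_pairing x && odd (strand_dots x)]).

End Stack.

Definition word_stack (n : nat) (w : seq 'I_n.+1) : dotted_pairing n.+1 :=
  foldr (fun (i : 'I_n.+1) D => stack (gen_diagram n i) D) (id_pairing n.+1, set0) w.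

Definition word_diagram (n : nat) (w : seq 'I_n.+1) : dotted_pairing n.+1 :=
  let: (C, dots) := word_stack w in
  (C, if odd #|dots| then first_chord n.+1 else dots).

(* [b n D] is the element given by a reduced word with diagram [D]. The case
   [n = 0] is excluded here and treated apart in [is_coef]: [TLD q 0] has a
   generator but there is only one diagram with one strand. *)
Definition is_diagram_basis (K : fieldType) (q : K)
    (b : forall n, diagram n.+1 -> TLD q n) : Prop :=
  forall n, 0 < n -> forall D : diagram n.+1,
    exists w : seq 'I_n.+1,
      [/\ reduced q w, word_diagram w = val D & b n D = word_elt q w].

Local Open Scope ring_scope.

Definition is_coef (K : fieldType) (q : K) (Q : forall n, TLD q n)
    (b : forall n, diagram n.+1 -> TLD q n)
    (coef : forall n, diagram n.+1 -> K) : Prop :=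
  (forall D : diagram 1, coef 0%N D = 1) /\
  (forall n, (0 < n)%N -> Q n = \sum_(D : diagram n.+1) coef n D *: b n D).

Definition odd_diagram (N : nat) (C : pairing N) : option (diagram N) :=
  [pick D | (conn D == C) && (ndots D == 1%N)].

Definition a_coef (K : fieldType) (q : K) (coef : forall n, diagram n.+1 -> K)
    (n : nat) (C : pairing n.+1) : K :=
  \sum_(D : diagram n.+1 | (conn D == C) && ~~ odd (ndots D)) coef n D
  - qint q 2 * (if odd_diagram C is Some D then coef n D else 0).

Local Open Scope nat_scope.

(* The element [i] of ['I_N.+1] is the position [i + 1] counted from 1, so the
   cap joins the points [i] and [i + 1] counted from 0. *)
Definition innermost (N : nat) (C : pairing N.+1) (i : 'I_N.+1) : bool :=
  C (inord i) == inord i.+1.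

Definition insert_pt (i x : nat) : nat := if x < i then x else x.+2.

Definition delete_pt (i y : nat) : nat := if y < i then y else y.-2.

Definition remove_cap (N : nat) (C : pairing N.+1) (i : 'I_N.+1) : pairing N :=
  [ffun x : 'I_N.*2 =>
     insubd x (delete_pt i (C (inord (insert_pt i x))))].

(* Main.v *)
Require Import Defs.
From HB Require Import structures.
From mathcomp Require Import all_boot all_order all_algebra.
From mathcomp Require Import zify ring.
From mathcomp Require Import generic_quotient fraction complex reals.

Set Implicit Arguments.
Unset Strict Implicit.
Unset Printing Implicit Defensive.

Import GRing.Theory.

Local Open Scope ring_scope.
Local Open Scope quotient_scope.

(** The mathematical idea is that a_n(C) is the coefficient of C in the type A
    Jones-Wenzl projection P on n + 1 strands. Sending both E_0 and E_1 to E_1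
    gives a homomorphism from TL^D to TL^A. The image of Q_n is killed by all
    generators and is the identity plus nonempty words, so it is P. A basis
    element with an even number of dots is sent to its connectivity, and one
    with an odd number of dots to -[2] times its connectivity, because its
    reduced word closes no loop in the first case and exactly one in the second.

    TL^A is replaced here by its left regular representation [rho false], on
    the vector space spanned by all chord diagrams; the identity connectivity is
    the vector [ket (id_state _)], and [proj_vec] is its image under Q_n. The two
    facts to prove are that the coordinates of [proj_vec] are the a_n(C)
    ([proj_vec_coord]) and that [proj_vec] satisfies the recurrence
    ([proj_vec_rec]).

    For the recurrence, let ins_k insert a chord joining two neighbouring points
    at place k of the circle of marked points, write x for [proj_vec], and put
    y := sum_k [k + 1] / [N] ins_k x_(N - 1), for N strands. Then y is killed by
    the generators: those acting away from the last strand commute with ins_k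
    and kill x_(N - 1), and for the last one a partial closure of x_(N - 1) is a
    multiple of x_(N - 2) ([cup_cap_rec_vec]), so that the terms cancel by the
    recurrence for N - 1. Hence Q_n y = y ([proj_fix]). On the other hand
    Q_n ins_k x_(N - 1) = Q_n ins_k (identity), since Q_n absorbs Q_(n - 1); and
    ins_k (identity) is the word E_n ... E_(k + 1) applied to the identity, which
    Q_n kills unless the word is empty ([proj_ins]). Thus Q_n y = x_N.

    For the number of loops, every word can be rewritten by the relations, never
    growing, into a canonical word ([red_canonical]), a product of tails
    E_m E_(m - 1) ... of which at most one runs through E_0 E_1. The point is
    that to the right of a factor E_0 E_1 the generators E_0 and E_1 act alike
    ([fork_blind]), so a second passage through E_0 E_1 can be shortened. A
    reduced word therefore equals its canonical word, whose action on the
    identity closes one loop if it runs through E_0 E_1 and none otherwise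
    ([act_canonical]). It remains to see that this loop carries one dot. In a
    second representation [rho true], where dots are kept and dotted loops
    count 0, a word through E_0 E_1 acts as 0, which forces a dotted loop; and
    the parity of the dots of the stacked diagram is that of the number of
    dotted loops ([word_state], [reduced_act]). *)

(** * Chord diagrams with labelled chords *)
Section Surgery.
Variable T : finType.

(** Each point carries the other end of its chord and the number of dots of the
    chord modulo 2. *)
Definition state := {ffun T -> T * bool}.

Definition valid (c : state) : bool :=
  [forall x, ((c x).1 != x) && (c (c x).1 == (x, (c x).2))].

(** The effect on top points [a], [b] of stacking a generator: its cap glues the
    two chords ending there into one, and its cup becomes a new chord; [e] says
    whether the cap and the cup are dotted. *)
Definition surg (a b : T) (e : bool) (c : state) : state :=
  [ffun x => if x == a then (b, e) else if x == b then (a, e) else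
     let y := c x in
     if y.1 == a then ((c b).1, y.2 (+) (c b).2 (+) e) else
     if y.1 == b then ((c a).1, y.2 (+) (c a).2 (+) e) else y].

Definition strip (c : state) : state := [ffun x => ((c x).1, false)].

Lemma valid_neq c x : valid c -> ((c x).1 == x) = false.
Proof. by move/forallP/(_ x)/andP=> [/negbTE]. Qed.

Lemma validK c x : valid c -> c (c x).1 = (x, (c x).2).
Proof. by move/forallP/(_ x)/andP=> [_ /eqP]. Qed.

Lemma valid_sym c x a : valid c -> ((c x).1 == a) = (x == (c a).1).
Proof. by move=> v; apply/eqP/eqP => [<-|->]; rewrite validK. Qed.

Lemma valid_lab c a : valid c -> (c (c a).1).2 = (c a).2.
Proof. by move=> v; rewrite validK. Qed.

Lemma surgE (c : state) a b e x : valid c ->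
  surg a b e c x = if x == a then (b, e) else if x == b then (a, e) else
     if x == (c a).1 then ((c b).1, (c a).2 (+) (c b).2 (+) e) else
     if x == (c b).1 then ((c a).1, (c a).2 (+) (c b).2 (+) e) else c x.
Proof.
move=> v; rewrite ffunE /= !(valid_sym _ _ v).
case: (x == a) => //; case: (x == b) => //.
case: (x =P (c a).1) => [->|_]; first by rewrite valid_lab.
by case: (x =P (c b).1) => [->|//]; rewrite valid_lab // (addbC (c b).2).
Qed.

Lemma surg_valid (c : state) a b e : a != b -> valid c -> valid (surg a b e c).
Proof.
move=> nab v; apply/forallP => x.
have nba : b != a by rewrite eq_sym.
rewrite !(surgE _ _ _ _ v).
have Ca := valid_neq a v; have Cb := valid_neq b v.
case: (x =P a) => [->|/eqP xa]; first by rewrite eqxx /= (negbTE nba) !eqxx.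
case: (x =P b) => [->|/eqP xb]; first by rewrite /= nab !eqxx.
have cab : (c a).1 == (c b).1 = false.
  by rewrite (valid_sym _ _ v) validK //= (negbTE nab).
have cba : (c b).1 == (c a).1 = false by rewrite eq_sym.
case: (x =P (c a).1) => [E|/eqP xca].
  have ba : (c b).1 == a = false by rewrite (valid_sym _ _ v) -E eq_sym (negbTE xb).
  by rewrite /= ba Cb E cba !eqxx.
case: (x =P (c b).1) => [E|/eqP xcb].
  have ba : (c a).1 == b = false by rewrite (valid_sym _ _ v) -E eq_sym (negbTE xa).
  by rewrite /= ba Ca E cab !eqxx.
rewrite !(valid_sym _ _ v) (negbTE xca) (negbTE xcb) !validK //= (negbTE xa) (negbTE xb).
by rewrite eqxx -(valid_sym _ _ v) (valid_neq _ v).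
Qed.

Lemma partner_eq (s : state) x y : valid s -> ((s x).1 == (s y).1) = (x == y).
Proof. by move=> v; rewrite (valid_sym _ _ v) validK. Qed.

Lemma surg_idem (s : state) a b e : a != b -> valid s ->
  surg a b e (surg a b e s) = surg a b e s.
Proof.
move=> nab v; have v' := surg_valid e nab v.
have nba : b == a = false by rewrite eq_sym (negbTE nab).
apply/ffunP => x; rewrite (surgE _ _ _ _ v').
have -> : surg a b e s a = (b, e) by rewrite ffunE eqxx.
have -> : surg a b e s b = (a, e) by rewrite ffunE nba eqxx.
rewrite /=; case: (x =P a) => [->|/eqP xa]; first by rewrite ffunE eqxx.
by case: (x =P b) => [->|/eqP xb] //; rewrite ffunE nba eqxx.
Qed.

Lemma surg_braid (s : state) a b c e f : a != b -> b != c -> a != c -> valid s ->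
  surg a b e (surg b c f (surg a b e s)) = surg a b e s.
Proof.
move=> nab nbc nac v; have v1 := surg_valid e nab v.
set s1 := surg a b e s in v1 *.
have v2 := surg_valid f nbc v1.
have nba : b == a = false by rewrite eq_sym (negbTE nab).
have s1a : s1 a = (b, e) by rewrite ffunE eqxx.
have s1b : s1 b = (a, e) by rewrite ffunE nba eqxx.
have s2b : surg b c f s1 b = (c, f) by rewrite ffunE eqxx.
have s2a : surg b c f s1 a = ((s1 c).1, e (+) (s1 c).2 (+) f).
  by rewrite (surgE _ _ _ _ v1) (negbTE nab) (negbTE nac) s1b eqxx.
apply/ffunP => x; rewrite (surgE _ _ _ _ v2) s2b s2a /=.
case: (x =P a) => [->|/eqP xa]; first by rewrite s1a.
case: (x =P b) => [->|/eqP xb]; first by rewrite s1b.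
rewrite (surgE _ _ _ _ v1) s1b /= (negbTE xa) (negbTE xb).
case: (x =P (s1 c).1) => [->|/eqP xc].
  by rewrite validK //; congr pair; case: (e) (s1 c).2 (f) => [] [] [].
case: (x =P c) => [->|/eqP xc'] //.
by rewrite [RHS]surjective_pairing; congr pair; case: (e) (s1 c).2 (f) => [] [] [].
Qed.

(** Gluing at [a], [b] creates the chord joining them and a chord joining their
    partners; gluing at the partners creates the same two chords in the other
    roles. On the identity this turns a left multiplication by a generator into
    a right one. *)
Lemma surg_partners (c : state) a b e : valid c -> (c a).1 != b ->
  (c a).2 = (c b).2 -> surg a b e c = surg (c a).1 (c b).1 e c.
Proof.
move=> v pb lab; have pa := valid_neq a v; have qb := valid_neq b v.
have qa : (c b).1 == a = false by rewrite (valid_sym _ _ v) eq_sym (negbTE pb).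
apply/ffunP => x; rewrite !(surgE _ _ _ _ v) !(validK _ v) /= lab addbb.
case: (x =P a) => [->|_]; first by rewrite eq_sym pa eq_sym qa.
case: (x =P b) => [->|_]; last by case: ifP => // _; case: ifP.
by rewrite eq_sym (negbTE pb) eq_sym qb.
Qed.

(** [xor_pair] compares labelled points up to an identity between exclusive
    disjunctions, by enumeration; [split_at] separates the case where [x] is the
    partner of [w]. *)
Local Ltac xor_pair := rewrite /=; congr (_, _); rewrite //=;
  repeat match goal with |- context [(?s ?u).2] => move: (s u).2 => [] end;
  repeat match goal with e : bool |- context [?e'] => constr_eq e e'; case: (e) end; done.
Local Ltac split_at s w x := case: ((s w).1 =P x) => [?|_]; [subst x; rewrite /= |].

(** Gluing at [a], [b] and gluing at [c], [d] act on disjoint places of the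
    picture; the case analysis runs over the ways in which chords of [s] link
    these four points. *)
Lemma surg_comm (s : state) a b c d e f : uniq [:: a; b; c; d] -> valid s ->
  surg a b e (surg c d f s) = surg c d f (surg a b e s).
Proof.
rewrite /= !inE !negb_or !andbT => /and3P[/and3P[ab ac ad] /andP[bc bd] cd] v.
have [v1 v2] := (surg_valid e ab v, surg_valid f cd v).
have [ba ca da] : [/\ b != a, c != a & d != a] by split; rewrite eq_sym.
have [cb db dc] : [/\ c != b, d != b & d != c] by split; rewrite eq_sym.
have sym u w : ((s u).1 == w) = ((s w).1 == u) by rewrite (valid_sym _ _ v) eq_sym.
have neq u w : u != w -> ((s u).1 == (s w).1) = false by rewrite partner_eq // => /negbTE.
apply/ffunP => x; rewrite (surgE _ _ _ _ v1) (surgE _ _ _ _ v2).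
case: (x =P a) => [->|/eqP xa].
  rewrite (negbTE ac) (negbTE ad) ![a == _]eq_sym !(valid_sym _ _ v1).
  by rewrite !(surgE _ _ _ _ v) eqxx /= (negbTE cb) (negbTE db).
case: (x =P b) => [->|/eqP xb].
  rewrite (negbTE bc) (negbTE bd) ![b == (_ _).1]eq_sym !(valid_sym _ _ v1).
  by rewrite !(surgE _ _ _ _ v) eqxx (negbTE ba) /= (negbTE ca) (negbTE da).
case: (x =P c) => [->|/eqP xc].
  rewrite ![c == (_ _).1]eq_sym !(valid_sym _ _ v2).
  by rewrite !(surgE _ _ _ _ v) eqxx /= (negbTE ad) (negbTE bd).
case: (x =P d) => [->|/eqP xd].
  rewrite ![d == (_ _).1]eq_sym !(valid_sym _ _ v2).
  by rewrite !(surgE _ _ _ _ v) eqxx (negbTE dc) /= (negbTE ac) (negbTE bc).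
rewrite !(surgE _ _ _ _ v) (negbTE xa) (negbTE xb) (negbTE xc) (negbTE xd).
rewrite !(negbTE ab, negbTE ac, negbTE ad, negbTE bc, negbTE bd, negbTE cd).
rewrite !(negbTE ba, negbTE ca, negbTE da, negbTE cb, negbTE db, negbTE dc).
rewrite ![_ == (s _).1]eq_sym (sym c a) (sym d a) (sym c b) (sym d b).
have swap u w : (s u).1 = w -> s w = (u, (s u).2) by move=> <-; exact: validK.
have neq' u w y : u != w -> (s u).1 = y -> (s w).1 == y = false.
  by move=> uw <-; rewrite neq // eq_sym.
have Fx := (eq_sym a x, eq_sym b x, eq_sym c x, eq_sym d x,
  negbTE xa, negbTE xb, negbTE xc, negbTE xd).
have Gx u : (x == (s u).1) = ((s u).1 == x) by rewrite eq_sym.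
pose lx := (neq _ _ ab, neq _ _ ac, neq _ _ ad, neq _ _ bc, neq _ _ bd, neq _ _ cd,
  neq _ _ ba, neq _ _ ca, neq _ _ da, neq _ _ cb, neq _ _ db, neq _ _ dc).
pose nn := (negbTE ab, negbTE ac, negbTE ad, negbTE bc, negbTE bd, negbTE cd,
  negbTE ba, negbTE ca, negbTE da, negbTE cb, negbTE db, negbTE dc).
case: ((s a).1 =P c) => [Eac|/eqP/negbTE nAc].
  rewrite (neq' _ _ _ ab Eac) (swap _ _ Eac) Eac /= ?nn.
  case: ((s b).1 =P d) => [Ebd|_].
    by rewrite (swap _ _ Ebd) Ebd /= !Fx.
  rewrite /= ?Fx ?Gx.
  split_at s b x; first by rewrite ?lx; xor_pair.
  by split_at s d x; first by xor_pair.
case: ((s a).1 =P d) => [Ead|/eqP/negbTE nAd].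
  rewrite (neq' _ _ _ ab Ead) (swap _ _ Ead) Ead /= ?nn.
  case: ((s b).1 =P c) => [Ebc|_].
    by rewrite (swap _ _ Ebc) Ebc /= !Fx.
  rewrite /= ?Fx ?Gx.
  split_at s b x; first by rewrite ?lx; xor_pair.
  by split_at s c x; first by xor_pair.
case: ((s b).1 =P c) => [Ebc|/eqP/negbTE nBc].
  rewrite (swap _ _ Ebc) Ebc /= ?nn ?Fx ?Gx.
  split_at s a x; first by rewrite ?lx; xor_pair.
  by split_at s d x; first by xor_pair.
case: ((s b).1 =P d) => [Ebd|/eqP/negbTE nBd].
  rewrite (swap _ _ Ebd) Ebd /= ?nn ?Fx ?Gx.
  split_at s a x; first by rewrite ?lx; xor_pair.
  by split_at s c x; first by xor_pair.
rewrite ?Gx.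
split_at s a x; first by rewrite ?lx.
split_at s b x; first by rewrite ?lx.
by [].
Qed.

End Surgery.

(** * Weights of loops *)
Section Weights.
Variables (T : finType) (K : fieldType) (d : K).

(** Stacking closes a loop when [a] and [b] are already joined; the loop carries
    the dot of that chord and the dot of the cap. Dotted loops count 0, and
    invalid states are discarded so that the relations hold on all states. *)
Definition loop_weight (a b : T) (e : bool) (c : state T) : K :=
  if ~~ valid c then 0 else
  if (c a).1 == b then (if (c a).2 == e then d else 0) else 1.

Lemma weight_idem a b e (s : state T) : a != b -> valid s ->
  loop_weight a b e (surg a b e s) = d.
Proof.
by move=> nab v; rewrite /loop_weight surg_valid // ffunE eqxx /= !eqxx.
Qed.

Lemma weight_braid a b c e f (s : state T) : a != b -> b != c -> a != c -> valid s ->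
  loop_weight b c f (surg a b e s) = 1 /\
  loop_weight a b e (surg b c f (surg a b e s)) = 1.
Proof.
move=> nab nbc nac v; have v1 := surg_valid e nab v.
have nba : b == a = false by rewrite eq_sym (negbTE nab).
rewrite /loop_weight !surg_valid //=; split.
  by rewrite ffunE nba eqxx /= (negbTE nac).
by rewrite (valid_sym _ _ (surg_valid f nbc v1)) [surg b c f _ _]ffunE eqxx (negbTE nac).
Qed.

(** A loop may be closed by either operation, according to the order in which
    they are made, but the number of loops and their dots are the same. *)
Lemma weight_comm (s : state T) a b c c' e f : uniq [:: a; b; c; c'] -> valid s ->
  loop_weight a b e (surg c c' f s) * loop_weight c c' f s =
  loop_weight c c' f (surg a b e s) * loop_weight a b e s.
Proof.
rewrite /= !inE !negb_or !andbT => /and3P[/and3P[ab ac ad] /andP[bc bd] cd] v.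
rewrite /loop_weight !surg_valid // v /=.
have [ba ca da] : [/\ b != a, c != a & c' != a] by split; rewrite eq_sym.
have [cb db dc] : [/\ c != b, c' != b & c' != c] by split; rewrite eq_sym.
pose nn := (negbTE ab, negbTE ac, negbTE ad, negbTE bc, negbTE bd, negbTE cd,
  negbTE ba, negbTE ca, negbTE da, negbTE cb, negbTE db, negbTE dc).
rewrite !(surgE _ _ _ _ v) !nn.
have swap u w : (s u).1 = w -> s w = (u, (s u).2) by move=> <-; exact: validK.
have neq' u w y : u != w -> (s u).1 = y -> ((s w).1 == y) = false.
  by move=> uw <-; rewrite partner_eq // eq_sym (negbTE uw).
rewrite ![_ == (s _).1]eq_sym.
have sym u w : ((s u).1 == w) = ((s w).1 == u) by rewrite (valid_sym _ _ v) eq_sym.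
rewrite (sym c a) (sym c' a).
case: ((s a).1 =P b) => [Eab|/eqP/negbTE nab].
  rewrite (swap _ _ Eab) Eab ?nn /= ?nn Eab eqxx; exact: mulrC.
case: ((s c).1 =P c') => [Ecd|/eqP/negbTE ncd].
  have Eca : (s a).1 == c = false by rewrite sym Ecd nn.
  have Edb : (s b).1 == c = false by rewrite sym Ecd nn.
  have Eda : (s a).1 == c' = false by rewrite sym (swap _ _ Ecd) /= nn.
  by rewrite Eca Edb Eda nab Ecd eqxx mulr1 mul1r.
rewrite !mulr1.
case: ((s a).1 =P c) => [Eac|/eqP/negbTE nAc].
  rewrite /= (sym c' b).
  case: ((s b).1 =P c') => [Ebd|//].
  rewrite (swap _ _ Eac) (swap _ _ Ebd) /=.
  by case: (s a).2 (s b).2 (e) (f) => [] [] [] [].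
case: ((s a).1 =P c') => [Ead|/eqP/negbTE nAd].
  rewrite (sym c b) /=; case: ((s b).1 =P c) => [Ebc|_].
    rewrite Ead eqxx (swap _ _ Ead) (swap _ _ Ebc) /=.
    by case: (s a).2 (s b).2 (e) (f) => [] [] [] [].
  by rewrite ncd.
by rewrite nab; case: ((s b).1 == c); rewrite /= ?nAd ?ncd.
Qed.

Lemma weight_dotted (s : state T) a b e : a != b -> valid s ->
  loop_weight a b e (surg a b (~~ e) s) = 0.
Proof.
by move=> nab v; rewrite /loop_weight surg_valid // ffunE eqxx /= eqxx; case: e.
Qed.

End Weights.

(** * Monomial matrices *)

(** The index 0 is left out: the extra dimension makes the size of the matrices
    a successor, so that they form an algebra. *)
Definition ket_index (S : finType) (s : S) : 'I_#|S|.+1 := lift ord0 (enum_rank s).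

(** The linear map sending the basis vector of [s] to [g s] times that of [f s].
    It is locked because comparing two such maps by computation would enumerate
    all states. *)
HB.lock Definition monomial (K : fieldType) (S S' : finType) (f : S -> S') (g : S -> K) :
    'M[K]_(#|S'|.+1, #|S|.+1) :=
  \sum_s g s *: delta_mx (ket_index (f s)) (ket_index s).

Section Monomial.
Variable K : fieldType.

Definition ket (S : finType) (s : S) : 'cV[K]_#|S|.+1 := delta_mx (ket_index s) 0.

Lemma ket_index_inj (S : finType) : injective (@ket_index S).
Proof. by move=> s t /lift_inj /enum_rank_inj. Qed.

Lemma ketE (S : finType) (s t : S) : ket s (ket_index t) 0 = (t == s)%:R.
Proof. by rewrite mxE eqxx andbT (inj_eq (@ket_index_inj S)). Qed.

Lemma ket_neq0 (S : finType) (s : S) : ket s != 0.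
Proof.
apply/eqP => /matrixP/(_ (ket_index s) 0); rewrite ketE eqxx mxE.
by move/eqP; rewrite oner_eq0.
Qed.

Lemma ket_scale_inj (S : finType) (s t : S) (a b : K) :
  a != 0 -> a *: ket s = b *: ket t -> s = t /\ a = b.
Proof.
move=> a0 /matrixP/(_ (ket_index s) 0); rewrite !mxE eqxx andbT mulr1 eqxx /=.
rewrite (inj_eq (@ket_index_inj S)) andbT; case: (s =P t) => [->|_] /= E.
  by rewrite mulr1 in E.
by move: a0; rewrite E mulr0 eqxx.
Qed.

Lemma monomial_ket (S S' : finType) (f : S -> S') (g : S -> K) s :
  monomial f g *m ket s = g s *: ket (f s).
Proof.
rewrite monomial.unlock mulmx_suml (bigD1 s) //= big1 ?addr0 => [|t ts].
  by rewrite -scalemxAl mul_delta_mx.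
rewrite -scalemxAl mul_delta_mx_0 ?scaler0 //.
by rewrite (inj_eq (@ket_index_inj S)).
Qed.

Lemma monomial_comp (S S' S'' : finType) (f : S' -> S'') (g : S' -> K)
    (f' : S -> S') (g' : S -> K) :
  monomial f g *m monomial f' g' = monomial (f \o f') (fun s => g (f' s) * g' s).
Proof.
rewrite !monomial.unlock mulmx_sumr; apply: eq_bigr => s _.
rewrite -scalemxAr mulmx_suml (bigD1 (f' s)) //= big1 ?addr0 => [|t ts].
  by rewrite -scalemxAl mul_delta_mx scalerA mulrC.
rewrite -scalemxAl mul_delta_mx_0 ?scaler0 //.
by rewrite (inj_eq (@ket_index_inj S')).
Qed.

Lemma eq_monomial (S S' : finType) (f f' : S -> S') (g g' : S -> K) :
  (forall s, g s = g' s) -> (forall s, g s != 0 -> f s = f' s) ->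
  monomial f g = monomial f' g'.
Proof.
move=> eg ef; rewrite !monomial.unlock; apply: eq_bigr => s _; rewrite -eg.
by case: (eqVneq (g s) 0) => [->|/ef ->]; rewrite ?scale0r.
Qed.

Lemma scale_monomial (S S' : finType) (f : S -> S') (g : S -> K) c :
  c *: monomial f g = monomial f (fun s => c * g s).
Proof. by rewrite !monomial.unlock scaler_sumr; apply: eq_bigr => s _; rewrite scalerA. Qed.

Lemma monomial0 (S S' : finType) (f : S -> S') (g : S -> K) :
  (forall s, g s = 0) -> monomial f g = 0.
Proof. by move=> h; rewrite monomial.unlock; apply: big1 => s _; rewrite h scale0r. Qed.

End Monomial.
Arguments ket {K S}.

(** * Two representations of the presented algebra *)
Section SurgeryOperators.
Variables (K : fieldType) (d : K) (T : finType).

Definition surg_mx (a b : T) (e : bool) : 'M[K]_#|state T|.+1 :=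
  monomial (surg a b e) (loop_weight d a b e).

Lemma weight_invalid (a b : T) e s : ~~ valid s -> loop_weight d a b e s = 0.
Proof. by rewrite /loop_weight => ->. Qed.

Lemma weight_neq0 (a b : T) e s : loop_weight d a b e s != 0 -> valid s.
Proof. by apply: contraNT => /weight_invalid ->. Qed.

Lemma surg_mxC (a b : T) e : a != b -> surg_mx a b e = surg_mx b a e.
Proof.
move=> ab; have ba : b == a = false by rewrite eq_sym (negbTE ab).
apply: eq_monomial => s.
  rewrite /loop_weight; case: (boolP (valid s)) => //= v.
  rewrite (valid_sym _ _ v) eq_sym; case: eqP => // <-.
  by rewrite validK.
move/weight_neq0 => v; apply/ffunP => x; rewrite !(surgE _ _ _ _ v).
have nP : ((s a).1 == (s b).1) = false by rewrite partner_eq // (negbTE ab).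
case: (x =P a) => [->|_]; first by rewrite (negbTE ab).
case: (x =P b) => // _.
case: (x =P (s a).1) => [->|_]; first by rewrite nP (addbC (s b).2).
by rewrite (addbC (s b).2).
Qed.

Lemma surg_mx_idem (a b : T) e : a != b ->
  surg_mx a b e *m surg_mx a b e = d *: surg_mx a b e.
Proof.
move=> ab; rewrite monomial_comp scale_monomial; apply: eq_monomial => s /=.
  case: (boolP (valid s)) => v; first by rewrite weight_idem.
  by rewrite (weight_invalid _ _ _ v) !mulr0.
case: (boolP (valid s)) => v; first by rewrite surg_idem.
by rewrite (weight_invalid _ _ _ v) mulr0 eqxx.
Qed.

Lemma surg_mx_braid (a b c : T) e f : a != b -> b != c -> a != c ->
  surg_mx a b e *m surg_mx b c f *m surg_mx a b e = surg_mx a b e.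
Proof.
move=> ab bc ac; rewrite !monomial_comp; apply: eq_monomial => s /=.
  case: (boolP (valid s)) => v; last by rewrite (weight_invalid _ _ _ v) !mulr0.
  by have [-> ->] := weight_braid d e f ab bc ac v; rewrite !mul1r.
case: (boolP (valid s)) => v; first by rewrite surg_braid.
by rewrite (weight_invalid _ _ _ v) mulr0 eqxx.
Qed.

Lemma surg_mx_comm (a b c c' : T) e f : uniq [:: a; b; c; c'] ->
  surg_mx a b e *m surg_mx c c' f = surg_mx c c' f *m surg_mx a b e.
Proof.
move=> u; rewrite !monomial_comp; apply: eq_monomial => s /=.
  case: (boolP (valid s)) => v; first exact: weight_comm.
  by rewrite !(weight_invalid _ _ _ v) !mulr0.
case: (boolP (valid s)) => v; first by rewrite surg_comm.
by rewrite (weight_invalid _ _ _ v) mulr0 eqxx.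
Qed.

(** This product is E_0 E_1 or E_1 E_0. The two stackings place the remaining
    dot on different chords; they agree only because the dotted loop they close
    counts 0. *)
Lemma surg_mx_dotted (a b : T) e : a != b ->
  surg_mx a b e *m surg_mx a b (~~ e) = 0.
Proof.
move=> ab; rewrite monomial_comp; apply: monomial0 => s /=.
case: (boolP (valid s)) => v; first by rewrite weight_dotted // mul0r.
by rewrite (weight_invalid _ _ _ v) mulr0.
Qed.

End SurgeryOperators.

Section Representation.
Variables (K : fieldType) (q : K).

Notation loopv := (- qint q 2).

Definition top_pt (n k : nat) : 'I_n.+1.*2 := rev_ord (inord k).

Lemma top_pt_eq n k l : (k < n.+1.*2)%N -> (l < n.+1.*2)%N ->
  (top_pt n k == top_pt n l) = (k == l).
Proof.
move=> hk hl; rewrite (inj_eq rev_ord_inj) -val_eqE /= !inordK //.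
Qed.

(** The generators 0 and 1 both act at position 1, hence the predecessor. With
    [e = false] they act alike and no dot ever appears, which gives the type A
    action; with [e = true] the generator 0 is dotted. *)
Definition gen_mx (n : nat) (e : bool) (i : nat) : 'M[K]_#|state 'I_n.+1.*2|.+1 :=
  surg_mx loopv (top_pt n i.-1) (top_pt n i.-1.+1) (e && (i == 0%N)).

Lemma gen_mx_idem n e i : (0 < n)%N -> (i <= n)%N ->
  gen_mx n e i *m gen_mx n e i = loopv *: gen_mx n e i.
Proof. by move=> n0 hi; apply: surg_mx_idem; rewrite top_pt_eq; lia. Qed.

Lemma gen_mx_braid n e i j : (0 < n)%N -> (i <= n)%N -> (j <= n)%N -> adjD i j ->
  gen_mx n e i *m gen_mx n e j *m gen_mx n e i = gen_mx n e i.
Proof.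
rewrite /adjD /edgeD => n0 hi hj ad.
have [E|E] : j.-1 = i.-1.+1 \/ i.-1 = j.-1.+1 by lia.
  by rewrite /gen_mx E surg_mx_braid // top_pt_eq; lia.
rewrite /gen_mx E !(@surg_mxC _ _ _ (top_pt n j.-1.+1)) ?top_pt_eq; try lia.
rewrite (@surg_mxC _ _ _ (top_pt n j.-1)) ?top_pt_eq; try lia.
by rewrite surg_mx_braid // top_pt_eq; lia.
Qed.

Lemma gen_mx_comm n e i j : (0 < n)%N -> (i <= n)%N -> (j <= n)%N ->
  i != j -> ~~ adjD i j -> gen_mx n e i *m gen_mx n e j = gen_mx n e j *m gen_mx n e i.
Proof.
rewrite /adjD /edgeD => n0 hi hj nij ad.
have [E|E] : i.-1 = j.-1 \/ (i.-1.+1 < j.-1)%N || (j.-1.+1 < i.-1)%N by lia.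
  have ab : top_pt n j.-1 != top_pt n j.-1.+1 by rewrite top_pt_eq; lia.
  rewrite /gen_mx E; case: e; last exact: erefl.
  have -> : (i == 0%N) = ~~ (j == 0%N) by lia.
  have h1 := surg_mx_dotted loopv true ab; have h2 := surg_mx_dotted loopv false ab.
  by case: (j == 0%N); [exact: etrans h2 (esym h1) | exact: etrans h1 (esym h2)].
apply: surg_mx_comm; rewrite /= !inE !top_pt_eq; lia.
Qed.

Lemma gen_mx_rel n e : (0 < n)%N ->
  TLD_relations q (fun i : 'I_n.+1 => gen_mx n e i : 'M[K]_#|state 'I_n.+1.*2|.+1).
Proof.
move=> n0; split=> [i|i j|i j].
- by apply: gen_mx_idem => //; rewrite -ltnS.
- by apply: gen_mx_braid => //; rewrite -ltnS.
- by move=> ij; apply: gen_mx_comm => //; rewrite -ltnS.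
Qed.

End Representation.

(** * Inserting a chord between two neighbouring points *)
Section Insertion.
Variable N : nat.
Local Notation st := (state 'I_N.*2).
Local Notation st1 := (state 'I_N.+1.*2).
Implicit Types (k : nat) (c : st).

Definition shift k (x : 'I_N.*2) : 'I_N.+1.*2 := inord (insert_pt k x).

(** The inverse of [remove_cap]: the new chord joins [k] and [k.+1], and the
    other points are renumbered by [shift k]. *)
Definition ins k c : st1 :=
  [ffun x : 'I_N.+1.*2 =>
     if x == inord k then (inord k.+1, false) else
     if x == inord k.+1 then (inord k, false) else
     if [pick y | shift k y == x] is Some y then (shift k (c y).1, (c y).2)
     else (x, false)].

Lemma val_shift k x : shift k x = insert_pt k x :> nat.
Proof.
rewrite /shift inordK // /insert_pt; have := ltn_ord x.
by case: ifP => _ h; rewrite !ltnS // ltnW // ltnW.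
Qed.

Lemma val_inord k : (k <= N.*2.+1)%N -> (inord k : 'I_N.+1.*2) = k :> nat.
Proof. by move=> h; rewrite inordK. Qed.

Lemma shift_inj k : injective (shift k).
Proof.
move=> x y /(congr1 val); rewrite /= !val_shift /insert_pt => E; apply: val_inj => /=.
by move: E; case: ifP; case: ifP; lia.
Qed.

Lemma shift_neq k x : (k <= N.*2)%N ->
  (shift k x == inord k) = false /\ (shift k x == inord k.+1) = false.
Proof.
move=> hk; rewrite -!val_eqE /= val_shift !val_inord; try lia.
by rewrite /insert_pt; split; case: ifP; lia.
Qed.

Lemma inord_neq k l : (k <= N.*2.+1)%N -> (l <= N.*2.+1)%N ->
  ((inord k : 'I_N.+1.*2) == inord l) = (k == l).
Proof. by move=> hk hl; rewrite -val_eqE /= !val_inord. Qed.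

Variant shift_spec k (x : 'I_N.+1.*2) : Prop :=
  | IsLeft of x = inord k | IsRight of x = inord k.+1
  | IsShift y of x = shift k y.

Lemma shiftP k x : (k <= N.*2)%N -> shift_spec k x.
Proof.
move=> hk; have hx := ltn_ord x; rewrite [X in (_ < X)%N]doubleS in hx.
case: (ltngtP x k) => [lt|gt|E]; last by apply: IsLeft; rewrite -E inord_val.
  have h : (x < N.*2)%N by lia.
  apply: (@IsShift _ _ (Ordinal h)); apply: val_inj; rewrite /= val_shift /insert_pt /=.
  by rewrite lt.
case: (eqVneq (x : nat) k.+1) => [E|nE]; first by apply: IsRight; rewrite -E inord_val.
have h : (x.-2 < N.*2)%N by lia.
apply: (@IsShift _ _ (Ordinal h)); apply: val_inj; rewrite /= val_shift /insert_pt /=.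
by case: ifP; lia.
Qed.

Lemma insL k c : ins k c (inord k) = (inord k.+1, false).
Proof. by rewrite ffunE eqxx. Qed.

Lemma insR k c : (k <= N.*2)%N -> ins k c (inord k.+1) = (inord k, false).
Proof. by move=> hk; rewrite ffunE inord_neq; [case: ifP; [lia|rewrite eqxx]|lia|lia]. Qed.

Lemma ins_shift k c x : (k <= N.*2)%N -> ins k c (shift k x) = (shift k (c x).1, (c x).2).
Proof.
move=> hk; have [h1 h2] := shift_neq x hk; rewrite ffunE h1 h2.
by case: pickP => [y /eqP/shift_inj -> //|/(_ x)]; rewrite eqxx.
Qed.

Lemma ins_valid k c : (k <= N.*2)%N -> valid (ins k c) = valid c.
Proof.
move=> hk; apply/forallP/forallP => v x.
  have := v (shift k x); rewrite !ins_shift //= ?ins_shift // (inj_eq (@shift_inj k)).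
  case: (_ != x) => //= /eqP[/shift_inj E1 E2]; apply/eqP.
  by rewrite [LHS]surjective_pairing E1 E2.
case: (shiftP x hk) => [->|->|y ->].
- by rewrite insL /= insR // eqxx inord_neq /=; lia.
- by rewrite insR //= insL eqxx inord_neq /=; lia.
- rewrite !ins_shift //= ?ins_shift // (inj_eq (@shift_inj k)).
  by have /andP[-> /eqP ->] := v y; rewrite /= !eqxx.
Qed.

Lemma surg_shift k c a b e : (k <= N.*2)%N ->
  surg (shift k a) (shift k b) e (ins k c) = ins k (surg a b e c).
Proof.
move=> hk; apply/ffunP => x; rewrite ffunE.
have E u : (inord k == shift k u) = false /\ (inord k.+1 == shift k u) = false.
  by have [h1 h2] := shift_neq u hk; rewrite eq_sym h1 eq_sym h2.
case: (shiftP x hk) => [->|->|y ->].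
- by rewrite !(E _).1 insL /= !(E _).2 insL.
- by rewrite !(E _).2 insR //= !(E _).1 insR.
rewrite !ins_shift //= !(inj_eq (@shift_inj k)) ffunE /=.
by do 2!case: ifP => //; case: ifP => //; case: ifP.
Qed.

Lemma surg_ins k c : (k <= N.*2)%N ->
  surg (inord k) (inord k.+1) false (ins k c) = ins k c.
Proof.
move=> hk; apply/ffunP => x; rewrite ffunE.
case: (shiftP x hk) => [->|->|y ->].
- by rewrite eqxx insL.
- by rewrite eqxx insR // inord_neq; [case: ifP; [lia|] | lia | lia].
have [h1 h2] := shift_neq y hk; rewrite h1 h2 ins_shift //=.
by have [-> ->] := shift_neq (c y).1 hk.
Qed.

Lemma shiftS k (y : 'I_N.*2) : y != k :> nat -> shift k.+1 y = shift k y.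
Proof.
move=> h; apply: val_inj; rewrite /= !val_shift /insert_pt.
by do 2!case: ifP; lia.
Qed.

Lemma shift_at k (y : 'I_N.*2) : y = k :> nat ->
  shift k y = inord k.+2 /\ shift k.+1 y = inord k.
Proof.
move=> E; have hy := ltn_ord y.
by split; apply: val_inj; rewrite /= val_shift /insert_pt E ?ltnn ?ltnSn val_inord; lia.
Qed.

(** A cap at [k], [k.+1] straightens the strand through the inserted chord
    [k.+1], [k.+2]; only the new cup remains. *)
Lemma surg_ins_down k c : (k < N.*2)%N -> valid c ->
  surg (inord k) (inord k.+1) false (ins k.+1 c) = ins k c.
Proof.
move=> hk v; have hk' := ltnW hk; apply/ffunP => x; rewrite ffunE.
case: (shiftP x hk') => [->|->|y ->].
- by rewrite eqxx insL.
- by rewrite eqxx insR // inord_neq; [case: ifP; [lia|] | lia | lia].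
have [h1 h2] := shift_neq y hk'; rewrite h1 h2 (ins_shift _ _ hk').
case: (eqVneq (y : nat) k) => [E|nE].
  have [-> <-] := shift_at E; rewrite insR //= ins_shift //=.
  have ny : (c y).1 != k :> nat.
    by apply: contraFN (valid_neq y v) => /eqP Ek; rewrite -val_eqE /= Ek E.
  by rewrite (shiftS ny) [inord k.+1 == _]eq_sym (shift_neq y hk).1 eqxx !addbF.
rewrite -(shiftS nE) ins_shift //=.
case: (eqVneq ((c y).1 : nat) k) => [E|nE'].
  by rewrite (shift_at E).2 eqxx insL /= !addbF (shift_at E).1.
by rewrite (shiftS nE'); have [-> ->] := shift_neq (c y).1 hk'.
Qed.

Lemma surg_ins_up k c : (k < N.*2)%N -> valid c ->
  surg (inord k.+1) (inord k.+2) false (ins k c) = ins k.+1 c.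
Proof.
move=> hk v; have hk' := ltnW hk; apply/ffunP => x; rewrite ffunE.
case: (shiftP x hk) => [->|->|y ->].
- by rewrite eqxx insL.
- by rewrite eqxx insR // inord_neq; [case: ifP; [lia|] | lia | lia].
have [h1 h2] := shift_neq y hk; rewrite h1 h2 (ins_shift _ _ hk).
case: (eqVneq (y : nat) k) => [E|nE].
  have [<- ->] := shift_at E; rewrite insL /= eqxx ins_shift //=.
  have ny : (c y).1 != k :> nat.
    by apply: contraFN (valid_neq y v) => /eqP Ek; rewrite -val_eqE /= Ek E.
  by rewrite (shiftS ny) addbF.
rewrite (shiftS nE) ins_shift //=.
case: (eqVneq ((c y).1 : nat) k) => [E|nE'].
  have [-> ->] := shift_at E; rewrite inord_neq; try lia.
  by rewrite eqxx insR // !addbF; case: ifP; [lia|].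
by rewrite -(shiftS nE'); have [-> ->] := shift_neq (c y).1 hk.
Qed.

End Insertion.

Lemma shift_shift N k j (y : 'I_N.*2) : (k <= j)%N ->
  shift j.+2 (shift k y) = shift k (shift j y).
Proof.
move=> h; apply: val_inj; rewrite /= !val_shift /insert_pt.
by do 4!case: ifP; lia.
Qed.

Lemma shift_inord N k j : (k <= N.*2.+1)%N -> 
  @shift N.+1 j (inord k) = inord (if k < j then k else k.+2)%N.
Proof.
move=> h; apply: val_inj; rewrite /= !val_shift /insert_pt !val_inord //.
  by case: ifP; lia.
Qed.

Lemma ins_ins N k j (c : state 'I_N.*2) : (k <= j)%N -> (j <= N.*2)%N ->
  ins j.+2 (ins k c) = ins k (ins j c).
Proof.
move=> kj jN; have kN := leq_trans kj jN.
have k2 : (k <= N.+1.*2)%N by lia.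
have j2 : (j.+2 <= N.+1.*2)%N by lia.
apply/ffunP => x; case: (shiftP x k2) => [->|->|y ->].
- rewrite insL [inord k](_ : _ = shift j.+2 (inord k : 'I_N.+1.*2)); last first.
    by rewrite shift_inord ?ltnS ?(leq_trans kj) //; lia.
  rewrite ins_shift // insL /= shift_inord; last by lia.
  by congr (inord _, _); case: ifP; lia.
- rewrite insR // [inord k.+1](_ : _ = shift j.+2 (inord k.+1 : 'I_N.+1.*2)); last first.
    by rewrite shift_inord ?ltnS ?kj //; lia.
  rewrite ins_shift // insR //= shift_inord; last by lia.
  by congr (inord _, _); case: ifP; lia.
rewrite (ins_shift _ _ k2); case: (shiftP y jN) => [->|->|z ->].
- rewrite insL /= !shift_inord; try lia.
  have -> : (if (j < k)%N then j else j.+2) = j.+2 by case: ifP; lia.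
  have -> : (if (j.+1 < k)%N then j.+1 else j.+3) = j.+3 by case: ifP; lia.
  by rewrite insL.
- rewrite insR //= !shift_inord; try lia.
  have -> : (if (j < k)%N then j else j.+2) = j.+2 by case: ifP; lia.
  have -> : (if (j.+1 < k)%N then j.+1 else j.+3) = j.+3 by case: ifP; lia.
  by rewrite insR.
by rewrite -shift_shift // !ins_shift //= ?ins_shift //= shift_shift.
Qed.

(** * Stacking a generator on a diagram *)
Section StackedDiagrams.
Local Open Scope nat_scope.
#[local] Opaque inord.

(** A chord is dotted when its smaller end is in the set of dots; the exclusive
    disjunction makes the label symmetric in the two ends. *)
Definition signed (N : nat) (D : dotted_pairing N) : state 'I_N.*2 :=
  [ffun x => (D.1 x, (x \in D.2) (+) (D.1 x \in D.2))].

Lemma signedK N (D : dotted_pairing N) x : valid (signed D) -> D.1 (D.1 x) = x.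
Proof. by move=> v; have := validK x v; rewrite ffunE => /(congr1 fst); rewrite /= ffunE. Qed.

Section Stacking.
Variables (n i : nat).
Hypotheses (n0 : 0 < n) (hi : i <= n).

Local Notation pt := 'I_n.+1.*2.
Local Notation U := (gen_diagram n i).
Local Notation a := (inord i.-1 : pt).
Local Notation b := (inord i.-1.+1 : pt).
Local Notation t := (top_pt n i.-1).
Local Notation t' := (top_pt n i.-1.+1).
Local Notation e := (i == 0).

Lemma val_a : a = i.-1 :> nat. Proof. by rewrite val_inord; lia. Qed.
Lemma val_b : b = i.-1.+1 :> nat. Proof. by rewrite val_inord; lia. Qed.
Lemma val_t : t = (n.+1.*2 - i.-1.+1) :> nat.
Proof. by rewrite /top_pt [LHS]/= val_a. Qed.
Lemma val_t' : t' = (n.+1.*2 - i.-1.+2) :> nat.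
Proof. by rewrite /top_pt [LHS]/= val_b. Qed.

Lemma neq_tt' : t != t'. Proof. by apply/eqP => /(congr1 (@nat_of_ord _)); rewrite val_t val_t'; lia. Qed.

Lemma top_t : (t < n.+1) = false. Proof. by rewrite val_t; lia. Qed.
Lemma top_t' : (t' < n.+1) = false. Proof. by rewrite val_t'; lia. Qed.
Lemma bot_a : a < n.+1. Proof. by rewrite val_a; lia. Qed.
Lemma bot_b : b < n.+1. Proof. by rewrite val_b; lia. Qed.

Lemma rev_bot (x : pt) : (rev_ord x < n.+1) = ~~ (x < n.+1).
Proof. by rewrite /=; have := ltn_ord x; lia. Qed.

Lemma gen_pairingE (x : pt) : U.1 x =
  if x == a then b else if x == b then a else if x == t then t' else
  if x == t' then t else rev_ord x.
Proof. by rewrite ffunE. Qed.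

Lemma bot_neq_top (x y : pt) : x < n.+1 -> (y < n.+1) = false -> (x == y) = false.
Proof. by move=> hx hy; apply/eqP => E; rewrite E hy in hx. Qed.

Lemma top_neq_bot (x y : pt) : (x < n.+1) = false -> y < n.+1 -> (x == y) = false.
Proof. by move=> hx hy; rewrite eq_sym bot_neq_top. Qed.

Lemma neq_ab : (b == a) = false.
Proof. by apply/eqP => /(congr1 (@nat_of_ord _)); rewrite val_a val_b; lia. Qed.

Lemma gen_pairingK x : U.1 (U.1 x) = x.
Proof.
rewrite [U.1 x]gen_pairingE.
case: (x =P a) => [->|/eqP xa]; first by rewrite gen_pairingE neq_ab eqxx.
case: (x =P b) => [->|/eqP xb]; first by rewrite gen_pairingE eqxx.
have ta := bot_neq_top bot_a top_t; have tb := bot_neq_top bot_b top_t.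
have ta' := bot_neq_top bot_a top_t'; have tb' := bot_neq_top bot_b top_t'.
case: (x =P t) => [->|/eqP xt].
  rewrite gen_pairingE eq_sym ta' eq_sym tb' eq_sym (negbTE neq_tt') eqxx //.
case: (x =P t') => [->|/eqP xt'].
  by rewrite gen_pairingE eq_sym ta eq_sym tb eqxx.
rewrite gen_pairingE !(can2_eq rev_ordK rev_ordK) !rev_ordK.
by rewrite (negbTE xa) (negbTE xb) (negbTE xt) (negbTE xt').
Qed.

Variable D : dotted_pairing n.+1.
Hypothesis vD : valid (signed D).
Local Notation C := (D.1).

Lemma signedE x : (signed D x).1 = C x. Proof. by rewrite ffunE. Qed.

Lemma CK x : C (C x) = x.
Proof. exact: signedK. Qed.

Lemma C_neq x : (C x == x) = false.
Proof. by have := valid_neq x vD; rewrite signedE. Qed.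

Lemma C_eq x y : (C x == y) = (x == C y).
Proof. by apply/eqP/eqP => [<-|->]; rewrite CK. Qed.

Local Notation lk := (link U D).

Lemma link_sym : symmetric lk.
Proof.
move=> [[] x] [[] y]; rewrite /link /=.
- by rewrite -(inj_eq (can_inj gen_pairingK)) gen_pairingK eq_sym.
- case: (x =P rev_ord y) => [->|ne]; first by rewrite rev_ordK eqxx !andbT rev_bot; case: (_ < _).
  rewrite andbF; case: (y =P rev_ord x) => [E|]; rewrite ?andbF //.
  by case: ne; rewrite E rev_ordK.
- case: (x =P rev_ord y) => [->|ne]; first by rewrite rev_ordK eqxx !andbT rev_bot; case: (_ < _).
  rewrite andbF; case: (y =P rev_ord x) => [E|]; rewrite ?andbF //.
  by case: ne; rewrite E rev_ordK.
- by rewrite eq_sym C_eq.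
Qed.

(** [Z] contains the ends of the chords that the cap of the generator glues
    together, and [strand y] the points of the lower diagram that lie on the
    same strand or loop as [y]. *)
Let Z : {set pt} := [set t; t'; C t; C t'].
Definition strand (y : pt) : {set pt} := if y \in Z then Z else [set y; C y].

(** A complete invariant of the connected components of the stacked picture:
    the points of the lower diagram on the component, or [None] for the new
    cup, which is disjoint from the lower diagram. *)
Definition component (u : bool * pt) : option {set pt} :=
  if ~~ u.1 then Some (strand u.2) else
  if u.2 < n.+1 then Some (strand (rev_ord u.2)) else
  if (u.2 == t) || (u.2 == t') then None else Some (strand u.2).

Lemma mem_strand y : y \in strand y.
Proof. by rewrite /strand; case: ifP => // _; rewrite !inE eqxx. Qed.

Lemma ZC y : (C y \in Z) = (y \in Z).
Proof. by rewrite !inE !C_eq !CK; do 4!case: (y == _). Qed.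

Lemma strandC y : strand (C y) = strand y.
Proof. by rewrite /strand ZC CK setUC. Qed.

Lemma strand_t : strand t = Z. Proof. by rewrite /strand !inE eqxx. Qed.
Lemma strand_t' : strand t' = Z. Proof. by rewrite /strand !inE eqxx orbT. Qed.

Lemma rev_a : rev_ord a = t. Proof. by []. Qed.
Lemma rev_b : rev_ord b = t'. Proof. by []. Qed.

Lemma link_component u v : lk u v -> component u = component v.
Proof.
case: u v => [[] x] [[] y]; rewrite /link /component /=; last first.
- by move/eqP->; rewrite strandC.
- by case: ltnP => //= hx /eqP ->; rewrite rev_bot -leqNgt hx rev_ordK.
- by case: ltnP => //= hx /eqP ->.
rewrite gen_pairingE => /eqP ->.
case: (x =P a) => [->|/eqP xa]; first by rewrite bot_a bot_b rev_a rev_b strand_t strand_t'.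
case: (x =P b) => [->|/eqP xb]; first by rewrite bot_a bot_b rev_a rev_b strand_t strand_t'.
case: (x =P t) => [->|/eqP xt]; first by rewrite top_t top_t' !eqxx orbT.
case: (x =P t') => [->|/eqP xt']; first by rewrite top_t top_t' !eqxx.
rewrite rev_bot; case: ltnP => hx /=; last by rewrite rev_ordK.
by rewrite !(inj_eq rev_ord_inj) (negbTE xa) (negbTE xb).
Qed.

Lemma connect_component u v : connect lk u v -> component u = component v.
Proof.
move/connectP => [p hp ->] {v}; elim: p u hp => //= v p IH u /andP[/link_component -> hp].
exact: IH.
Qed.

Local Notation cn := (connect lk).
Lemma cn_sym u v : cn u v = cn v u.
Proof. exact: (sym_connect_sym link_sym). Qed.

Lemma cn_chord y : cn (false, y) (false, C y).
Proof. by apply: connect1; rewrite /link /=. Qed.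

Lemma cn_tt' : cn (false, t') (false, t).
Proof.
apply: (@connect_trans _ _ (true, b)).
  by apply: connect1; rewrite /link /= top_t' /= -rev_b rev_ordK eqxx.
apply: (@connect_trans _ _ (true, a)).
  by apply: connect1; rewrite /link [_ == _]/= gen_pairingE neq_ab !eqxx.
by apply: connect1; rewrite /link /= bot_a /= -rev_a eqxx.
Qed.

Lemma cn_Z y : y \in Z -> cn (false, y) (false, t).
Proof.
rewrite !inE => /orP[/orP[/orP[]|]|] /eqP ->; first exact: connect0.
- exact: cn_tt'.
- by rewrite cn_sym cn_chord.
- by apply: connect_trans cn_tt'; rewrite cn_sym cn_chord.
Qed.

Lemma cn_strand y y' : strand y = strand y' -> cn (false, y) (false, y').
Proof.
move=> E; have := mem_strand y'; rewrite -E /strand; case: ifP => hy.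
  by move=> hy'; apply: (connect_trans (cn_Z hy)); rewrite cn_sym cn_Z.
by rewrite !inE => /orP[] /eqP ->; [exact: connect0 | exact: cn_chord].
Qed.

Lemma component_rep u S : component u = Some S ->
  exists2 y, cn u (false, y) & strand y = S.
Proof.
case: u => [[] x]; rewrite /component /=; last by case=> <-; exists x.
case: ifP => hx.
  case=> <-; exists (rev_ord x) => //.
  by apply: connect1; rewrite /link /= hx !eqxx.
case: ifP => // /norP[xt xt'] [<-]; exists x => //.
apply: (@connect_trans _ _ (true, rev_ord x)).
  apply: connect1; rewrite /link [_ == _]/= gen_pairingE (negbTE xt) (negbTE xt').
  by rewrite (top_neq_bot hx bot_a) (top_neq_bot hx bot_b) eqxx.
by apply: connect1; rewrite /link /= rev_bot hx /= rev_ordK eqxx.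
Qed.

(** Links preserve [component] by inspection; conversely every node other than
    the ends of the new cup is linked to a point of the lower diagram, and the
    points of a strand are linked through chords and through the cap. *)
Lemma connectE u v : cn u v = (component u == component v).
Proof.
apply/idP/eqP => [/connect_component //|].
case Eu: (component u) => [S|] Ev.
  have [y cy sy] := component_rep Eu; have [y' cy' sy'] := component_rep (esym Ev).
  apply: (connect_trans cy); rewrite cn_sym; apply: (connect_trans cy').
  by apply: cn_strand; rewrite sy.
have none w : component w = None -> w = (true, t) \/ w = (true, t').
  by case: w => [[] x]; rewrite /component //=; case: ifP => // _;
     case: ifP => // /orP[] /eqP ->; [left | right].
have ctt' : cn (true, t) (true, t').
  apply: connect1; rewrite /link [_ == _]/= gen_pairingE.
  by rewrite (top_neq_bot top_t bot_a) (top_neq_bot top_t bot_b) !eqxx.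
by case: (none _ Eu) (none _ (esym Ev)) => -> [] ->; rewrite ?connect0 // cn_sym.
Qed.

Lemma component_boundary x : component (boundary x) =
  if (x == t) || (x == t') then None else Some (strand x).
Proof.
rewrite /component /boundary /= leqNgt; case: (boolP (x < n.+1)) => hx //=.
by rewrite (bot_neq_top hx top_t) (bot_neq_top hx top_t').
Qed.

Local Notation S := (surg t t' e (signed D)).

Lemma surg_signed x : S x =
  if x == t then (t', e) else if x == t' then (t, e) else
  if x == C t then (C t', (signed D t).2 (+) (signed D t').2 (+) e) else
  if x == C t' then (C t, (signed D t).2 (+) (signed D t').2 (+) e) else signed D x.
Proof. by rewrite surgE // !signedE. Qed.

Lemma strand_eqZ y : (Z == strand y) = (y \in Z).
Proof.
rewrite /strand; case: ifP => hy; first by rewrite eqxx.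
by apply/eqP => E; move: hy; rewrite E !inE eqxx.
Qed.

Lemma strand_outside x y : x \notin Z -> y != x ->
  (strand x == strand y) = (y == C x).
Proof.
move=> hx nyx; apply/eqP/eqP => [E|->]; last by rewrite strandC.
have := mem_strand y; rewrite -E /strand (negbTE hx) !inE (negbTE nyx).
by move/eqP.
Qed.

Lemma boundary_connect x y :
  (y != x) && cn (boundary x) (boundary y) = (y == (S x).1).
Proof.
rewrite connectE !component_boundary surg_signed.
have nt't : (t' == t) = false by rewrite eq_sym (negbTE neq_tt').
case: (x =P t) => [->|/eqP xt] /=.
  case: (y =P t) => [->|_] /=; first by rewrite (negbTE neq_tt').
  by case: (y =P t').
case: (x =P t') => [->|/eqP xt'] /=.
  case: (y =P t') => [->|_] /=; first by rewrite nt't.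
  by rewrite orbF; case: (y =P t).
case: (x =P C t) => [E|/eqP xCt] /=.
  have hx : strand x = Z by rewrite E strandC strand_t.
  have n1 : (t == C t') = false by rewrite -C_eq -E (negbTE xt').
  have n2 : (t' == C t') = false by rewrite eq_sym C_neq.
  case: (y =P t) => [->|/eqP yt] /=; first by rewrite andbF n1.
  case: (y =P t') => [->|/eqP yt'] /=; first by rewrite andbF n2.
  have -> : (Some (strand x) == Some (strand y)) = (y \in Z).
    by rewrite -strand_eqZ hx.
  rewrite !inE (negbTE yt) (negbTE yt') -E /=.
  case: (y =P x) => [->|_] //=; rewrite E (inj_eq (can_inj CK)).
  by rewrite (negbTE neq_tt').
case: (x =P C t') => [E|/eqP xCt'] /=.
  have hx : strand x = Z by rewrite E strandC strand_t'.
  have n1 : (t' == C t) = false by rewrite -C_eq -E (negbTE xt).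
  have n2 : (t == C t) = false by rewrite eq_sym C_neq.
  case: (y =P t) => [->|/eqP yt] /=; first by rewrite andbF n2.
  case: (y =P t') => [->|/eqP yt'] /=; first by rewrite andbF n1.
  have -> : (Some (strand x) == Some (strand y)) = (y \in Z).
    by rewrite -strand_eqZ hx.
  rewrite !inE (negbTE yt) (negbTE yt') -E /=.
  case: (y =P x) => [->|_] //=; rewrite ?orbF // E (inj_eq (can_inj CK)).
  by rewrite nt't.
have xZ : x \notin Z by rewrite !inE !negb_or xt xt' xCt xCt'.
have nC u : (x == C u) = false -> (u == C x) = false by rewrite -C_eq eq_sym.
rewrite signedE.
case: (y =P t) => [->|/eqP yt] /=; first by rewrite andbF nC // (negbTE xCt).
case: (y =P t') => [->|/eqP yt'] /=; first by rewrite andbF nC // (negbTE xCt').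
case: (y =P x) => [->|/eqP yx] /=; first by rewrite eq_sym C_neq.
exact: strand_outside.
Qed.

Lemma S_valid : valid S. Proof. exact: surg_valid neq_tt' vD. Qed.

Lemma stack_pairingE x : stack_pairing U D x = (S x).1.
Proof.
rewrite ffunE; case: pickP => [y|none]; first by rewrite boundary_connect => /eqP.
by have := none (S x).1; rewrite boundary_connect eqxx.
Qed.

Lemma odd_cardU1 (T : finType) (x : T) (A B : {set T}) : x \notin A ->
  odd #|(x |: A) :&: B| = (x \in B) (+) odd #|A :&: B|.
Proof.
move=> xA; rewrite setIUl cardsU.
have -> : [set x] :&: B :&: (A :&: B) = set0.
  by apply/setP => y; rewrite !inE; case: eqP => // ->; rewrite (negbTE xA) andbF.
rewrite cards0 subn0 oddD; congr (_ (+) _).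
case: (boolP (x \in B)) => xB.
  by rewrite (setIidPl _) ?cards1 // sub1set.
by rewrite (_ : [set x] :&: B = set0) ?cards0 //; apply/setP => y; rewrite !inE;
   case: eqP => // ->; rewrite (negbTE xB).
Qed.

Lemma card_bool_prod (T : finType) (P : pred (bool * T)) :
  #|[set u | P u]| = #|[set y | P (true, y)]| + #|[set y | P (false, y)]|.
Proof.
rewrite -!sum1dep_card (eq_bigl (fun u => true && P (u.1, u.2))); last by case.
by rewrite -(pair_big_dep xpredT (fun l y => P (l, y)) (fun _ _ => 1)) /= big_bool.
Qed.

Definition strand_label x : nat :=
  #|[set y | (component (boundary x) == component (false, y)) && (y \in D.2)]| +
  #|[set y | (component (boundary x) == component (true, y)) && (y \in U.2)]|.

Lemma strand_dotsE x : strand_dots U D x = strand_label x.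
Proof.
rewrite /strand_dots card_bool_prod addnC /=.
by congr (_ + _); apply: eq_card => y; rewrite !inE connectE.
Qed.

Lemma gen_dots : U.2 = if e then [set a; t'] else set0.
Proof.
rewrite /gen_diagram /=; case: eqP => // ->; congr (_ |: [set _]).
Qed.

Lemma odd_card1 (T : finType) (x : T) (B : {set T}) : odd #|[set x] :&: B| = (x \in B).
Proof. by rewrite -[[set x]]setU0 odd_cardU1 ?inE // set0I cards0 addbF. Qed.

(** When the generator is dotted, its two dots sit on the cap, which belongs to
    the component [Z], and on the new cup. *)
Lemma odd_gen_dots (B : option {set pt}) :
  odd #|[set y | (B == component (true, y)) && (y \in U.2)]| =
  e && ((B == Some Z) (+) (B == None)).
Proof.
rewrite gen_dots; case: e => /=; last first.
  by rewrite (_ : [set _ | _] = set0) ?cards0 //; apply/setP => y; rewrite !inE andbF.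
rewrite (_ : [set _ | _] = [set a; t'] :&: [set y | B == component (true, y)]); last first.
  by apply/setP => y; rewrite !inE andbC.
rewrite odd_cardU1 ?odd_card1 !inE /component /= ?(bot_neq_top bot_a top_t') //.
by rewrite bot_a rev_a strand_t top_t' eqxx orbT.
Qed.

Lemma odd_strand_dots (A : {set pt}) x :
  odd #|[set y | (strand x == strand y) && (y \in A)]| =
  if x \in Z then (if C t == t' then (t \in A) (+) (t' \in A)
    else ((t \in A) (+) (C t \in A)) (+) ((t' \in A) (+) (C t' \in A)))
  else (x \in A) (+) (C x \in A).
Proof.
have -> : [set y | (strand x == strand y) && (y \in A)] = strand x :&: A.
  apply/setP => y; rewrite !inE; congr (_ && _); apply/eqP/idP => [->|].
    exact: mem_strand.
  rewrite {1}/strand; case: ifP => hx; rewrite {1}/strand ?hx.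
    by move=> hy; rewrite /strand hy.
  rewrite !inE => /orP[] /eqP ->; first by rewrite /strand hx.
  by rewrite strandC /strand hx.
rewrite /strand; case: ifP => hx; last first.
  by rewrite odd_cardU1 ?odd_card1 // inE eq_sym C_neq.
have tCt : (t == C t) = false by rewrite eq_sym C_neq.
have tCt' : (t' == C t') = false by rewrite eq_sym C_neq.
case: (C t =P t') => [E|/eqP nE].
  have -> : Z = [set t; t'].
    by apply/setP => y; rewrite !inE -E CK; case: (y == t); case: (y == C t).
  by rewrite odd_cardU1 ?odd_card1 // inE neq_tt'.
rewrite /Z -!setUA !odd_cardU1 ?odd_card1 ?inE.
- by rewrite -!addbA; congr (_ (+) _); rewrite addbCA.
- by rewrite (inj_eq (can_inj CK)) neq_tt'.
- by rewrite negb_or eq_sym nE tCt'.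
- by rewrite !negb_or neq_tt' tCt -C_eq nE.
Qed.

Lemma odd_strand_label x : odd (strand_label x) = (S x).2.
Proof.
rewrite /strand_label oddD odd_gen_dots component_boundary surg_signed.
case: (x =P t) => [->|/eqP xt] /=.
  rewrite (_ : [set _ | _] = set0); first by rewrite cards0 /= andbT.
  by apply/setP => y; rewrite !inE.
case: (x =P t') => [_|/eqP xt'] /=.
  rewrite (_ : [set _ | _] = set0); first by rewrite cards0 /= andbT.
  by apply/setP => y; rewrite !inE.
have -> : (Some (strand x) == Some Z) = (x \in Z).
  by rewrite -strand_eqZ eq_sym.
have -> : [set y | (Some (strand x) == component (false, y)) & y \in D.2] =
          [set y | (strand x == strand y) & y \in D.2] by [].
rewrite odd_strand_dots addbF !ffunE /= !inE (negbTE xt) (negbTE xt') /=.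
case: (x =P C t) => [E|_] /=; first by rewrite -E (negbTE xt') andbT.
case: (x =P C t') => [E|_] /=; last by rewrite andbF addbF.
by rewrite C_eq -E (_ : t == x = false) ?andbT // eq_sym (negbTE xt).
Qed.

(** The stacking of the definition, by paths in a graph, agrees with the explicit
    gluing of chords. *)
Theorem signed_stack : signed (stack U D) = S.
Proof.
apply/ffunP => x; rewrite ffunE /= stack_pairingE !inE /chord !stack_pairingE.
rewrite !strand_dotsE !odd_strand_label.
have vS := S_valid; rewrite (validK x vS) /= [RHS]surjective_pairing; congr (_, _).
have := valid_neq x vS; rewrite -val_eqE /=.
by case: ltngtP => //= _ _; rewrite ?addbF.
Qed.

Lemma stack_dots_chord : (stack U D).2 \subset chord (stack U D).1.
Proof. by apply/subsetP => x; rewrite inE => /andP[]. Qed.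

End Stacking.

Lemma double_card_dots N (D : dotted_pairing N) : valid (signed D) ->
  D.2 \subset chord D.1 -> \sum_x ((signed D x).2 : nat) = (#|D.2|).*2.
Proof.
move=> v /subsetP sub.
have CC x : D.1 (D.1 x) = x by exact: signedK.
under eq_bigr => x _.
  rewrite ffunE /= (_ : nat_of_bool _ = (x \in D.2) + (D.1 x \in D.2)); last first.
    case: (boolP (x \in D.2)) => hx; case: (boolP (D.1 x \in D.2)) => hy //.
    by have := sub _ hx; have := sub _ hy; rewrite /chord !unfold_in CC; lia.
  over.
rewrite big_split /= -[RHS]addnn; congr (_ + _).
  by rewrite -sum1_card [RHS]big_mkcond.
rewrite (reindex_inj (can_inj CC)) /=; under eq_bigr => x _ do rewrite CC.
by rewrite -sum1_card [RHS]big_mkcond.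
Qed.

(** Dots disappear in pairs, except those on a loop; so the parity of the number
    of dots changes exactly when a dotted loop is dropped. The sums count each
    dotted chord at both ends. *)
Lemma odd_labels_surg (T : finType) (c : state T) a b e m m' : valid c -> a != b ->
  \sum_x ((c x).2 : nat) = m.*2 -> \sum_x ((surg a b e c x).2 : nat) = m'.*2 ->
  odd m' = odd m (+) (((c a).1 == b) && ((c a).2 != e)).
Proof.
move=> v nab; have nba : (b == a) = false by rewrite eq_sym (negbTE nab).
have Sa : surg a b e c a = (b, e) by rewrite surgE // eqxx.
have Sb : surg a b e c b = (a, e) by rewrite surgE // nba eqxx.
case: ((c a).1 =P b) => [E|/eqP nE].
  have split2 (F : T -> nat) :
      \sum_x F x = F a + (F b + \sum_(x | (x != a) && (x != b)) F x).
    by rewrite (bigD1 a) //= (bigD1 b) 1?eq_sym.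
  have Eb : c b = (a, (c a).2) by rewrite -E validK.
  rewrite !split2 Sa Sb Eb /=.
  have -> : \sum_(x | (x != a) && (x != b)) ((surg a b e c x).2 : nat) =
            \sum_(x | (x != a) && (x != b)) ((c x).2 : nat).
    apply: eq_bigr => x /andP[/negbTE xa /negbTE xb].
    by rewrite surgE // E Eb xa xb.
  case: (c a).2; case: e {Sa Sb} => /=; lia.
have pa : (c a).1 != a by rewrite valid_neq.
have pb : (c b).1 != b by rewrite valid_neq.
have qa : (c b).1 != a by rewrite valid_sym // eq_sym.
have pq : (c b).1 != (c a).1 by rewrite partner_eq // nba.
pose P x := [&& x != a, x != b, x != (c a).1 & x != (c b).1].
have split4 (F : T -> nat) : \sum_x F x = F a + (F b + (F (c a).1 + (F (c b).1 + \sum_(x | P x) F x))).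
  rewrite (bigD1 a) //= (bigD1 b) 1?eq_sym //= (bigD1 (c a).1) /= ?pa ?nE //.
  rewrite (bigD1 (c b).1) /= ?qa ?pb ?pq //; do 4!congr (_ + _).
  by apply: eq_bigl => x; rewrite /P -!andbA.
rewrite !split4 Sa Sb /= !valid_lab //.
have -> : \sum_(x | P x) ((surg a b e c x).2 : nat) = \sum_(x | P x) ((c x).2 : nat).
  apply: eq_bigr => x /and4P[/negbTE xa /negbTE xb /negbTE xpa /negbTE xpb].
  by rewrite surgE // xa xb xpa xpb.
rewrite !(surgE _ _ _ _ v) (negbTE pa) (negbTE nE) eqxx (negbTE qa) (negbTE pb) (negbTE pq) eqxx /=.
move: (\sum_(x | P x) _) (c a).2 (c b).2 => r l l'; clear -m m'.
by case: l; case: l'; case: e => /=; lia.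
Qed.

End StackedDiagrams.

(* From here on these are used through their lemmas only; unfolding them makes
   conversion enumerate finite types. *)
Opaque surg ins inord top_pt.

(** * Insertion operators and tails *)
Section InsertionOperators.
Variables (K : fieldType) (d : K).

Definition ins_mx (N k : nat) :
    'M[K]_(#|state 'I_N.+1.*2|.+1, #|state 'I_N.*2|.+1) :=
  monomial (@ins N k) (fun c => (valid c)%:R).

Definition cup_cap_mx (n k : nat) : 'M[K]_#|state 'I_n.+1.*2|.+1 :=
  surg_mx d (inord k) (inord k.+1) false.

Lemma ins_mx_ket N k (c : state 'I_N.*2) : valid c ->
  ins_mx N k *m ket c = ket (ins k c).
Proof. by move=> v; rewrite monomial_ket v scale1r. Qed.

Lemma surg_mx_shift N k (a b : 'I_N.*2) e : (k <= N.*2)%N -> a != b ->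
  surg_mx d (shift k a) (shift k b) e *m ins_mx N k = ins_mx N k *m surg_mx d a b e.
Proof.
move=> hk ab; rewrite !monomial_comp; apply: eq_monomial => c /=; last first.
  by move=> _; rewrite surg_shift.
case: (boolP (valid c)) => v; last first.
  by rewrite (weight_invalid _ _ _ _ v) !mulr0.
rewrite surg_valid // mul1r mulr1 /loop_weight ins_valid // v /=.
by rewrite ins_shift //= (inj_eq (@shift_inj N k)).
Qed.

(** Gluing at neighbours [p], [p.+1] commutes with the insertion of a chord
    elsewhere, up to renumbering; the side condition excludes an insertion
    between the two points. *)
Lemma cup_cap_far N k p : (k <= N.+1.*2)%N -> (p <= N.*2)%N -> (p.+1 != k)%N ->
  cup_cap_mx N.+1 (if (p < k)%N then p else p.+2) *m ins_mx N.+1 k =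
  ins_mx N.+1 k *m cup_cap_mx N p.
Proof.
move=> hk hp pk.
have ab : (inord p : 'I_N.+1.*2) != inord p.+1 by rewrite inord_neq; lia.
have := surg_mx_shift false hk ab; rewrite !shift_inord; try lia.
have -> : (if p.+1 < k then p.+1 else p.+3)%N = (if p < k then p else p.+2).+1%N.
  by case: ifP; case: ifP; lia.
exact.
Qed.

Lemma cup_cap_loop N k : (k <= N.*2)%N ->
  cup_cap_mx N k *m ins_mx N k = d *: ins_mx N k.
Proof.
move=> hk; rewrite monomial_comp scale_monomial.
apply: eq_monomial => c /=; last by move=> _; rewrite surg_ins.
rewrite /loop_weight ins_valid //; case: (valid c); rewrite ?mul0r ?mulr0 //=.
by rewrite insL /= !eqxx.
Qed.

Lemma cup_cap_down N k : (k < N.*2)%N ->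
  cup_cap_mx N k *m ins_mx N k.+1 = ins_mx N k.
Proof.
move=> hk; rewrite monomial_comp; apply: eq_monomial => c /=; last first.
  case: (boolP (valid c)) => v; last by rewrite mulr0 eqxx.
  by rewrite surg_ins_down.
rewrite /loop_weight ins_valid //; case: (boolP (valid c)) => v; rewrite ?mul0r ?mulr0 //=.
have [y Ey] : exists y : 'I_N.*2, y = k :> nat by exists (Ordinal hk).
rewrite -(shift_at Ey).2 ins_shift //= [_ == inord _](shift_neq _ _).1 ?mulr1 //.
Qed.

Lemma cup_cap_up N k : (k < N.*2)%N ->
  cup_cap_mx N k.+1 *m ins_mx N k = ins_mx N k.+1.
Proof.
move=> hk; have hk' := ltnW hk.
rewrite monomial_comp; apply: eq_monomial => c /=; last first.
  case: (boolP (valid c)) => v; last by rewrite mulr0 eqxx.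
  by rewrite surg_ins_up.
rewrite /loop_weight ins_valid //; case: (boolP (valid c)) => v; rewrite ?mul0r ?mulr0 //=.
by rewrite insR //= inord_neq ?mulr1; [case: ifP => //; lia | lia | lia].
Qed.

Lemma ins_mx_swap N k j : (k <= j)%N -> (j <= N.*2)%N ->
  ins_mx N.+1 j.+2 *m ins_mx N k = ins_mx N.+1 k *m ins_mx N j.
Proof.
move=> kj jN; have kN := leq_trans kj jN.
rewrite !monomial_comp; apply: eq_monomial => c /=.
  by rewrite !ins_valid.
by move=> _; rewrite ins_ins.
Qed.

Definition id_state (N : nat) : state 'I_N.*2 := [ffun x => (rev_ord x, false)].

Lemma id_state_valid N : valid (id_state N).
Proof.
apply/forallP => x; rewrite !ffunE /= rev_ordK eqxx andbT -val_eqE /=.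
by have := ltn_ord x; lia.
Qed.

Lemma id_stateS N : id_state N.+1 = ins N (id_state N).
Proof.
have hN : (N <= N.*2)%N by lia.
apply/ffunP => x; rewrite ffunE; case: (shiftP x hN) => [->|->|y ->].
- rewrite insL; congr (_, _); apply: val_inj; rewrite /= !val_inord; lia.
- rewrite insR //; congr (_, _); apply: val_inj; rewrite /= !val_inord; lia.
rewrite ins_shift // ffunE; congr (_, _); apply: val_inj; rewrite /= !val_shift /insert_pt /=.
by have := ltn_ord y; do 2!case: ifP; lia.
Qed.

End InsertionOperators.

Section Tails.
Variables (K : fieldType) (q : K).
Notation loopv := (- qint q 2).
Notation cup_cap := (cup_cap_mx loopv).
Notation ins_mx := (ins_mx K).

Lemma val_rev N (x : 'I_N) : rev_ord x = (N - x.+1)%N :> nat.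
Proof. by []. Qed.

Lemma top_ptE n k : (k <= n.*2.+1)%N -> top_pt n k = inord (n.*2.+1 - k).
Proof. by move=> h; apply: ord_inj; rewrite val_rev !val_inord; lia. Qed.

Lemma gen_mxE n i : (0 < n)%N -> (i <= n)%N ->
  gen_mx q n false i = cup_cap n (n.*2 - i.-1).
Proof.
move=> n0 hi; rewrite /gen_mx surg_mxC; last by rewrite top_pt_eq; lia.
rewrite !top_ptE; try lia; rewrite /cup_cap_mx.
by congr (surg_mx _ (inord _) (inord _) _); lia.
Qed.

Lemma gen_mx_ins n i k : (0 < n)%N -> (i <= n)%N -> (k <= n.+1)%N ->
  gen_mx q n.+1 false i *m ins_mx n.+1 k = ins_mx n.+1 k *m gen_mx q n false i.
Proof.
move=> n0 hi hk; rewrite !gen_mxE; try lia.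
have h1 : (k <= n.+1.*2)%N by lia.
have h2 : (n.*2 - i.-1 <= n.*2)%N by lia.
have h3 : ((n.*2 - i.-1).+1 != k)%N by lia.
have := cup_cap_far loopv h1 h2 h3.
have -> : (if n.*2 - i.-1 < k then n.*2 - i.-1 else (n.*2 - i.-1).+2)%N = (n.+1.*2 - i.-1)%N.
  by case: ifP; lia.
exact.
Qed.

(** [cup_cap n k] with [k < n] glues at bottom points: it is the right
    multiplication by a generator, and commutes with the left action. *)
Lemma gen_mx_cup_cap n i k : (0 < n)%N -> (i <= n)%N -> (k < n)%N ->
  gen_mx q n false i *m cup_cap n k = cup_cap n k *m gen_mx q n false i.
Proof.
move=> n0 hi hk; rewrite (gen_mxE n0 hi); apply: surg_mx_comm.
by rewrite /= !inE !inord_neq; lia.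
Qed.

Lemma gen_mx_id n i : (0 < n)%N -> (i <= n)%N ->
  gen_mx q n false i *m ket (id_state n.+1) = cup_cap n i.-1 *m ket (id_state n.+1).
Proof.
move=> n0 hi; rewrite (gen_mxE n0 hi).
have v := id_state_valid n.+1; set k := (n.*2 - i.-1)%N.
have kb : (inord i.-1 : 'I_n.+1.*2) != inord i.-1.+1 by rewrite inord_neq; lia.
have Ea : id_state n.+1 (inord k) = (inord i.-1.+1, false).
  by rewrite ffunE; congr (_, _); apply: ord_inj; rewrite val_rev !val_inord; lia.
have Eb : id_state n.+1 (inord k.+1) = (inord i.-1, false).
  by rewrite ffunE; congr (_, _); apply: ord_inj; rewrite val_rev !val_inord; lia.
have Ec : id_state n.+1 (inord i.-1.+1) = (inord k, false).
  by rewrite -[inord i.-1.+1]/((inord i.-1.+1, false).1) -Ea validK // Ea.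
rewrite /cup_cap_mx (surg_mxC _ _ kb) /surg_mx.
rewrite monomial_ket.
rewrite monomial_ket.
have nk : (inord i.-1.+1 == inord k.+1 :> 'I_n.+1.*2) = false by rewrite inord_neq; lia.
have nk' : (inord k == inord i.-1 :> 'I_n.+1.*2) = false by rewrite inord_neq; lia.
rewrite /loop_weight v Ea Ec /= nk nk' [in LHS](surg_partners _ v) ?Ea ?Eb //=.
by rewrite nk.
Qed.

Definition word_mx (n : nat) (e : bool) (w : seq nat) : 'M[K]_#|state 'I_n.+1.*2|.+1 :=
  \prod_(i <- w) gen_mx q n e i.

(** The word of the insertion of a chord at [k] into the identity, see
    [act_tail]. *)
Definition tail (n k : nat) : seq nat := rev (iota k.+1 (n - k)).

Notation act := word_mx.

Lemma act_nil n e : act n e [::] = 1%:M.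
Proof. by rewrite /word_mx big_nil. Qed.

Lemma act_cons n e i w : act n e (i :: w) = gen_mx q n e i *m act n e w.
Proof. by rewrite /word_mx big_cons. Qed.

Lemma act_cat n e w w' : act n e (w ++ w') = act n e w *m act n e w'.
Proof. by rewrite /word_mx big_cat. Qed.

Lemma act_ins n w k : (0 < n)%N -> all (leq^~ n) w -> (k <= n.+1)%N ->
  act n.+1 false w *m ins_mx n.+1 k = ins_mx n.+1 k *m act n false w.
Proof.
move=> n0 + hk; elim: w => [_|i w IH /= /andP[hi hw]].
  by rewrite !act_nil mul1mx mulmx1.
by rewrite !act_cons -mulmxA (IH hw) !mulmxA (gen_mx_ins n0 hi hk).
Qed.

Lemma act_cup_cap n w k : (0 < n)%N -> all (leq^~ n) w -> (k < n)%N ->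
  act n false w *m cup_cap n k = cup_cap n k *m act n false w.
Proof.
move=> n0 + hk; elim: w => [_|i w IH /= /andP[hi hw]].
  by rewrite !act_nil mul1mx mulmx1.
by rewrite !act_cons -mulmxA (IH hw) !mulmxA (gen_mx_cup_cap n0 hi hk).
Qed.

Lemma tailS n k : (k < n)%N -> tail n k = tail n k.+1 ++ [:: k.+1].
Proof.
move=> h; rewrite /tail (_ : n - k = (n - k.+1).+1)%N; last by lia.
by rewrite /= rev_cons cats1.
Qed.

Lemma mem_tail n k i : i \in tail n k -> (i <= n)%N.
Proof. by rewrite mem_rev mem_iota; lia. Qed.

(** The diagram of E_n ... E_(k + 1) is a chord inserted at [k] in the identity.
    Going down in [k], the new rightmost letter is a right multiplication, which
    moves the inserted chord one place to the left. *)
Lemma act_tail n k : (0 < n)%N -> (k <= n)%N ->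
  act n false (tail n k) *m ket (id_state n.+1) = ket (ins k (id_state n)).
Proof.
move=> n0 kn; rewrite -(subKn kn); elim: (n - k)%N (leq_subr k n) => [|j IH] hj.
  by rewrite subn0 /tail subnn act_nil mul1mx id_stateS.
rewrite tailS; last by lia.
rewrite act_cat act_cons act_nil mulmx1 -mulmxA gen_mx_id; try lia.
rewrite mulmxA act_cup_cap; try lia; last first.
  by apply/allP => i; apply: mem_tail.
have E : ((n - j.+1).+1 = n - j)%N by lia.
rewrite -mulmxA E IH; last by lia.
rewrite -ins_mx_ket ?id_state_valid // -E mulmxA cup_cap_down; last by lia.
by rewrite ins_mx_ket // id_state_valid.
Qed.

End Tails.

(** * The recurrence for the projected identity *)
Section Recurrence.
Variables (K : fieldType) (q : K).
Notation loopv := (- qint q 2).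
Notation cup_cap := (cup_cap_mx loopv).
Notation ins_mx := (ins_mx K).
Notation gen_mx := (gen_mx q).
Notation act := (word_mx q).

Lemma eval_intertwine n a b (E1 : 'I_n.+1 -> 'M[K]_a.+1) (E2 : 'I_n.+1 -> 'M[K]_b.+1)
    (T : 'M[K]_(a.+1, b.+1)) (s : expr K n) :
  (forall i, E1 i *m T = T *m E2 i) -> eval E1 s *m T = T *m eval E2 s.
Proof.
move=> h; elim: s => //= [|| s IH|s IHs t IHt|s IHs t IHt|c s IH].
- by rewrite mul0mx mulmx0.
- by rewrite mul1mx mulmx1.
- by rewrite mulNmx mulmxN IH.
- by rewrite mulmxDl mulmxDr IHs IHt.
- by rewrite -[LHS]mulmxA IHt mulmxA IHs -[LHS]mulmxA.
- by rewrite -scalemxAl -scalemxAr IH.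
Qed.

Definition rho (n : nat) (e : bool) : TLD q n -> 'M[K]_#|state 'I_n.+1.*2|.+1 :=
  TLD_lift (fun i : 'I_n.+1 => gen_mx n e i : 'M[K]_#|state 'I_n.+1.*2|.+1).

Section Morphism.
Variables (n : nat) (e : bool).
Hypothesis n0 : (0 < n)%N.

Lemma rho_gen i : rho e (gen q i : TLD q n) = gen_mx n e i.
Proof. by have [h _ _ _ _] := TLD_universal (gen_mx_rel q e n0); apply: h. Qed.

Lemma rho1 : rho e (1 : TLD q n) = 1%:M.
Proof. by have [_ h _ _ _] := TLD_universal (gen_mx_rel q e n0); apply: h. Qed.

Lemma rhoM x y : rho e (x * y : TLD q n) = rho e x *m rho e y.
Proof. by have [_ _ h _ _] := TLD_universal (gen_mx_rel q e n0); apply: h. Qed.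

Lemma rhoD x y : rho e (x + y : TLD q n) = rho e x + rho e y.
Proof. by have [_ _ _ h _] := TLD_universal (gen_mx_rel q e n0); apply: h. Qed.

Lemma rhoZ c x : rho e (c *: x : TLD q n) = c *: rho e x.
Proof. by have [_ _ _ _ h] := TLD_universal (gen_mx_rel q e n0); apply: h. Qed.

Lemma rho0 : rho e (0 : TLD q n) = 0.
Proof. by rewrite -(scale0r 0) rhoZ scale0r. Qed.

Lemma rho_sum (I : finType) (F : I -> TLD q n) :
  rho e (\sum_i F i) = \sum_i rho e (F i).
Proof. by apply: (big_morph _ rhoD rho0). Qed.

Lemma rhoN x : rho e (- x : TLD q n) = - rho e x.
Proof. by rewrite -scaleN1r rhoZ scaleN1r. Qed.

Lemma rho_eval m (F : 'I_m.+1 -> TLD q n) (s : expr K m) :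
  rho e (eval F s) = eval (fun i => rho e (F i)) s.
Proof.
elim: s => //= [|| s IH|s IHs t IHt|s IHs t IHt|c s IH].
- exact: rho0.
- exact: rho1.
- by rewrite rhoN IH.
- by rewrite rhoD IHs IHt.
- by rewrite rhoM IHs IHt.
- by rewrite rhoZ IH.
Qed.

Lemma rho_word (w : seq 'I_n.+1) : rho e (word_elt q w) = act n e (map val w).
Proof.
elim: w => [|i w IH]; first by rewrite /word_elt big_nil rho1 act_nil.
by rewrite /word_elt big_cons rhoM rho_gen map_cons act_cons -IH.
Qed.

End Morphism.

Lemma rho_cup_cap n k (x : TLD q n) : (0 < n)%N -> (k < n)%N ->
  rho false x *m cup_cap n k = cup_cap n k *m rho false x.
Proof.
move=> n0 hk; apply: eval_intertwine => i.
by apply: gen_mx_cup_cap => //; rewrite -ltnS.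
Qed.

(** Inserting a chord intertwines the actions on [n.+1] and [n.+2] strands,
    because the generators up to [n] act on top points numbered after the
    inserted chord. *)
Lemma rho_incl n k (x : TLD q n) (h : (n <= n.+1)%N) : (0 < n)%N -> (k <= n.+1)%N ->
  rho false (TLD_incl h x) *m ins_mx n.+1 k = ins_mx n.+1 k *m rho false x.
Proof.
move=> n0 hk; rewrite /TLD_incl /TLD_lift rho_eval //; apply: eval_intertwine => i.
by rewrite rho_gen //=; apply: gen_mx_ins => //; rewrite -ltnS.
Qed.

Variable Q : forall n, TLD q n.
Hypothesis hQ : is_projection Q.
Hypothesis Qfix : forall n (y : 'cV[K]_#|state 'I_n.+1.*2|.+1), (0 < n)%N ->
  (forall i : 'I_n.+1, gen_mx n false i *m y = 0) -> rho false (Q n) *m y = y.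
Hypothesis qint_neq0 : forall m, qint q m.+1 != 0.
Hypothesis q_neq0 : q != 0.
Hypothesis q2_neq1 : q - q^-1 != 0.

(** Indexed by the number of strands. The values at 0 and 1 are set apart: the
    algebra [TLD q 0] has a generator, although there is only one connectivity
    on one strand. *)
Definition proj_vec (N : nat) : 'cV[K]_#|state 'I_N.*2|.+1 :=
  match N with
  | 0 => ket (id_state 0)
  | 1 => ket (id_state 1)
  | n.+2 => rho false (Q n.+1) *m ket (id_state n.+2)
  end.

Arguments proj_vec : simpl never.

Lemma gen_proj_vec n i : (0 < n)%N -> (i <= n)%N ->
  gen_mx n false i *m proj_vec n.+1 = 0.
Proof.
case: n => // n n0 hi; rewrite /proj_vec mulmxA.
have [_ _ h] := hQ n.+1; have [+ _] := h (inord i).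
move/(congr1 (rho false)); rewrite rhoM // rho_gen // rho0 // inordK // => ->.
by rewrite mul0mx.
Qed.

Lemma proj_gen n i : (0 < n)%N -> (i <= n)%N ->
  rho false (Q n) *m gen_mx n false i = 0.
Proof.
case: n => // n n0 hi.
have [_ _ h] := hQ n.+1; have [_ +] := h (inord i).
by move/(congr1 (rho false)); rewrite rhoM // rho_gen // rho0 // inordK.
Qed.

(** The projection is killed on the right as well: a gluing at the bottom
    commutes with Q_n, and on the identity it is the action of a generator. *)
Lemma cup_cap_proj_vec n k : (0 < n)%N -> (k < n)%N -> cup_cap n k *m proj_vec n.+1 = 0.
Proof.
case: n => // n n0 hk; rewrite /proj_vec mulmxA -rho_cup_cap // -mulmxA.
have := @gen_mx_id K q n.+1 k.+1 n0 hk; rewrite [k.+1.-1]/= => <-.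
by rewrite mulmxA proj_gen // mul0mx.
Qed.

(** Q_n absorbs the smaller projection, so that only ins_k (identity) matters;
    this is a tail applied to the identity, whose first letter is killed by Q_n
    unless the tail is empty. *)
Lemma proj_ins n k : (0 < n)%N -> (k <= n)%N ->
  rho false (Q n) *m (ins_mx n k *m proj_vec n) = if k == n then proj_vec n.+1 else 0.
Proof.
case: n => // n n0 hk.
have -> : rho false (Q n.+1) *m (ins_mx n.+1 k *m proj_vec n.+1) =
          rho false (Q n.+1) *m ket (ins k (id_state n.+1)).
  case: n n0 hk => [|n] n0 hk.
    by rewrite /proj_vec ins_mx_ket // id_state_valid.
  rewrite /proj_vec [ins_mx _ _ *m (_ *m _)]mulmxA.
  have h : (n.+1 < n.+3)%N by lia.
  have [_ hi _] := hQ n.+2; have [+ _] := hi (Ordinal h).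
  move/(congr1 (rho false)); rewrite rhoM // => E.
  have hk' : (k <= n.+2)%N by lia.
  rewrite -(rho_incl (Q n.+1) (leq_ord (Ordinal h))) //.
  rewrite -[(rho _ (TLD_incl _ _) *m _) *m _]mulmxA [LHS]mulmxA.
  by rewrite [X in X *m _ = _]E ins_mx_ket // id_state_valid.
rewrite -(act_tail q) //; case: eqP => [->|nk].
  by rewrite /tail subnn act_nil mul1mx.
rewrite mulmxA; have -> : tail n.+1 k = n.+1 :: tail n k.
  rewrite /tail (_ : n.+1 - k = (n - k).+1)%N; last by lia.
  by rewrite -[(n - k).+1]addn1 iotaD rev_cat /= (_ : k.+1 + (n - k) = n.+1)%N //; lia.
by rewrite act_cons mulmxA proj_gen // !mul0mx.
Qed.

Lemma qint_rec m : qint q 2 * qint q m.+1 = qint q m.+2 + qint q m.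
Proof.
rewrite /qint !exprS expr0 !mulr1; have h1 : q ^+ m != 0 by rewrite expf_neq0.
rewrite !invfM; field.
rewrite h1 q_neq0 /=; have := q2_neq1; rewrite -(mulrI_eq0 _ (mulfI q_neq0)).
by rewrite mulrBr mulfV ?andbT.
Qed.

Lemma qint0 : qint q 0 = 0.
Proof. by rewrite /qint expr0 invr1 subrr mul0r. Qed.

Definition rec_vec N : 'cV[K]_#|state 'I_N.+1.*2|.+1 :=
  \sum_(k < N.+1) (qint q k.+1 / qint q N.+1) *: (ins_mx N k *m proj_vec N).

(** The closure of the last strand, followed by a new vertical strand. The chord
    inserted at [m] closes a loop and contributes -[2] = -([m + 2] + [m]) / [m + 1];
    the one at [m - 1] is straightened and contributes [m] / [m + 1]; for the
    others the gluing passes to the bottom of the smaller projection, which it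
    kills. *)
Lemma cup_cap_rec_vec m :
  cup_cap m m *m rec_vec m = - (qint q m.+2 / qint q m.+1) *: (ins_mx m m *m proj_vec m).
Proof.
rewrite /rec_vec mulmx_sumr big_ord_recr /= -scalemxAr mulmxA cup_cap_loop; last by lia.
rewrite -scalemxAl scalerA divff // mul1r.
have -> : \sum_(i < m) cup_cap m m *m ((qint q i.+1 / qint q m.+1) *: (ins_mx m i *m proj_vec m)) =
  (qint q m / qint q m.+1) *: (ins_mx m m *m proj_vec m).
  case: m => [|m]; first by rewrite big_ord0 qint0 mul0r scale0r.
  rewrite big_ord_recr /= -scalemxAr mulmxA cup_cap_up; last by lia.
  rewrite big1 ?add0r // => i _; rewrite -scalemxAr mulmxA.
  case: m i => [|m] i; first by case: i.
  have hi := ltn_ord i.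
  have h1 : (i <= m.+2.*2)%N by lia.
  have h2 : (m <= m.+1.*2)%N by lia.
  have h3 : (m.+1 != i)%N by lia.
  have := cup_cap_far loopv h1 h2 h3; rewrite ifN -?leqNgt // => ->.
  by rewrite -mulmxA cup_cap_proj_vec // mulmx0 scaler0.
rewrite -scalerDl; congr (_ *: _).
apply: (mulIf (qint_neq0 m)); rewrite mulrDl mulNr qint_rec mulfVK // mulNr mulfVK //.
by rewrite opprD addrC addrNK.
Qed.

(** Both sides are compared through Q_n, which fixes the right-hand side once it
    is known to be killed by all generators. *)
Theorem proj_vec_rec N : proj_vec N.+1 = rec_vec N.
Proof.
elim: N => [|m IH].
  rewrite /rec_vec big_ord1 divff // scale1r /proj_vec ins_mx_ket ?id_state_valid //.
  by rewrite -id_stateS.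
have killed (i : 'I_m.+2) : gen_mx m.+1 false i *m rec_vec m.+1 = 0.
  case: (boolP ((0 < m) && (i <= m))%N) => [/andP[m0 hi]|hm].
    rewrite /rec_vec mulmx_sumr big1 // => k _; rewrite -scalemxAr mulmxA.
    rewrite gen_mx_ins //; last by rewrite -ltnS.
    by rewrite -mulmxA gen_proj_vec // mulmx0 scaler0.
  (* The generator acting on the last two strands; for [m = 0] this includes
     the generator 0. *)
  rewrite gen_mxE //; last by rewrite -ltnS.
  have -> : (m.+1.*2 - i.-1 = m.+2)%N by have := ltn_ord i; lia.
  rewrite /rec_vec mulmx_sumr big_ord_recr /= -scalemxAr mulmxA cup_cap_up; last by lia.
  rewrite divff // scale1r.
  under eq_bigr => k _.
    have hk := ltn_ord k.
    have h1 : (k <= m.+1.*2)%N by lia.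
    have h2 : (m <= m.*2)%N by lia.
    have h3 : (m.+1 != k)%N by lia.
    rewrite -scalemxAr mulmxA.
    have := cup_cap_far loopv h1 h2 h3; rewrite ifN -?leqNgt // => ->.
    rewrite -mulmxA IH cup_cap_rec_vec -scalemxAr mulmxA -ins_mx_swap //.
    rewrite scalerA mulrN (_ : _ / _ * _ = qint q k.+1 / qint q m.+1); last first.
      by rewrite mulrA mulfVK.
    rewrite scaleNr -mulmxA scalemxAr.
    over.
  by rewrite sumrN -mulmx_sumr IH addNr.
rewrite -(Qfix _ killed) // {1}/rec_vec mulmx_sumr big_ord_recr /=.
rewrite -scalemxAr proj_ins // eqxx divff // scale1r big1 ?add0r // => k _.
rewrite -scalemxAr proj_ins //; last by have := ltn_ord k; lia.
by case: eqP => [E|_]; [have := ltn_ord k; lia | rewrite scaler0].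
Qed.

End Recurrence.

(** * Normal form of words *)
Section NormalForm.
Variables (K : fieldType) (q : K) (n : nat).
Notation loopv := (- qint q 2).

(** Words with letters in [nat] make sense for all [n] at once; the letters
    are always assumed to be at most [n]. *)
Definition genN (i : nat) : TLD q n := gen q (inord i).
Definition wordN (w : seq nat) : TLD q n := \prod_(i <- w) genN i.

Lemma genN_idem i : genN i * genN i = loopv *: genN i.
Proof. by have [h _ _] := TLD_gen_rel q n; rewrite /genN h. Qed.

Lemma genN_braid i j : (i <= n)%N -> (j <= n)%N -> adjD i j -> genN i * genN j * genN i = genN i.
Proof.
have [_ h _] := TLD_gen_rel q n => hi hj ad.
by apply: (h (inord i) (inord j)); rewrite !inordK.
Qed.

Lemma genN_comm i j : (i <= n)%N -> (j <= n)%N -> ~~ adjD i j -> genN i * genN j = genN j * genN i.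
Proof.
have [_ _ h] := TLD_gen_rel q n => hi hj ad; case: (eqVneq i j) => [->//|ij].
by apply: (h (inord i) (inord j)); rewrite -?val_eqE /= !inordK.
Qed.

Lemma wordN_nil : wordN [::] = 1. Proof. by rewrite /wordN big_nil. Qed.
Lemma wordN_cons i w : wordN (i :: w) = genN i * wordN w. Proof. by rewrite /wordN big_cons. Qed.
Lemma wordN_cat u v : wordN (u ++ v) = wordN u * wordN v. Proof. by rewrite /wordN big_cat. Qed.
Lemma wordN1 i : wordN [:: i] = genN i. Proof. by rewrite wordN_cons wordN_nil mulr1. Qed.

Lemma wordN_comm i w : (i <= n)%N -> all (leq^~ n) w ->
  all (fun j => ~~ adjD i j) w -> genN i * wordN w = wordN w * genN i.
Proof.
move=> hi; elim: w => [|j w IH] /=; first by rewrite wordN_nil mulr1 mul1r.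
move=> /andP[hj hw] /andP[aj aw].
by rewrite wordN_cons mulrA (genN_comm hi hj aj) -mulrA IH // mulrA.
Qed.

Lemma wordN_comm2 u w : all (leq^~ n) u -> all (leq^~ n) w ->
  all (fun i => all (fun j => ~~ adjD i j) w) u -> wordN u * wordN w = wordN w * wordN u.
Proof.
elim: u => [|i u IH] /=; first by rewrite wordN_nil mulr1 mul1r.
move=> /andP[hi hu] hw /andP[ai au].
by rewrite wordN_cons -mulrA IH // mulrA wordN_comm // mulrA.
Qed.

(** Right multiplication of [x] does not distinguish the two legs 0 and 1 of the
    graph, even after the letters k, ..., 2. The latter are included to make
    the property stable under right multiplication. *)
Definition fork_blind (x : TLD q n) : Prop :=
  forall k, (0 < k <= n)%N -> x * wordN (tail k 1) * genN 0 = x * wordN (tail k 1) * genN 1.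

Lemma tail_split k j : (0 < j)%N -> (j <= k)%N -> tail k 1 = tail k j ++ tail j 1.
Proof.
move=> j0 jk; rewrite /tail -rev_cat; congr rev.
by rewrite (_ : j.+1 = 2 + (j - 1))%N -?iotaD; [congr iota; lia | lia].
Qed.

Lemma tail_top k : (0 < k)%N -> tail k.+1 1 = k.+1 :: tail k 1.
Proof.
by move=> k0; rewrite (@tail_split k.+1 k) // {1}/tail subSn // subnn.
Qed.

Lemma tail_top' k : (1 < k)%N -> tail k 1 = k :: tail k.-1 1.
Proof. by case: k => // k; apply: tail_top. Qed.

Lemma all_tail k j m : (k <= m)%N -> all (leq^~ m) (tail k j).
Proof. by move=> h; apply/allP => i /mem_tail; lia. Qed.

Lemma tail_ge k j i : i \in tail k j -> (j < i <= k)%N.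
Proof. by rewrite mem_rev mem_iota; lia. Qed.

Lemma tail_far_comm k j l (w : seq nat) : (k <= n)%N -> (1 < j)%N ->
  all (leq^~ l) w -> (l < j)%N -> (l <= n)%N ->
  wordN (tail k j) * wordN w = wordN w * wordN (tail k j).
Proof.
move=> kn j1 hw lj ln; apply: wordN_comm2; first exact: all_tail.
  by apply: sub_all hw => i /=; lia.
apply/allP => i /tail_ge hi; apply/allP => m /(allP hw) hm.
by rewrite /adjD /edgeD; lia.
Qed.

Lemma fork_far k a x : (k <= n)%N -> (1 < k)%N -> (a <= 1)%N ->
  x * genN a * wordN (tail k 1) * genN a = x * genN a * wordN (tail k 2).
Proof.
move=> kn k1 a1; rewrite (@tail_split k 2) // wordN_cat.
have -> : tail 2 1 = [:: 2]%N by [].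
have cW : wordN (tail k 2) * genN a = genN a * wordN (tail k 2).
  have := @tail_far_comm k 2 1 [:: a] kn; rewrite !wordN1 /= andbT; apply; lia.
have br : genN a * genN 2 * genN a = genN a by apply: genN_braid; rewrite /adjD /edgeD; lia.
have E : genN a * (wordN (tail k 2) * genN 2) * genN a = genN a * wordN (tail k 2).
  by rewrite !mulrA -cW -[in RHS]br !mulrA.
rewrite wordN1 -!mulrA; congr (x * _); by rewrite !mulrA -[RHS]E !mulrA.
Qed.

Lemma fork_blind1 x : (0 < n)%N -> fork_blind x -> x * genN 0 = x * genN 1.
Proof. by move=> n0 /(_ 1%N); rewrite n0 /tail /= wordN_nil !mulr1; apply. Qed.

Lemma fork_blind_mull y x : fork_blind x -> fork_blind (y * x).
Proof. by move=> h k hk; have := h k hk; rewrite -!mulrA => ->. Qed.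

(** Multiplying by [genN j] in front of k, ..., 2 either commutes to the right,
    or lengthens the tail ([j = k.+1]), or repeats a letter ([j = k]), or cuts the
    tail down to j, ..., 2 by a braid relation; if [j <= 1], the letter 2 lies
    between two letters of the same leg and is cancelled. *)
Lemma fork_blind_mulr x j : (j <= n)%N -> fork_blind x -> fork_blind (x * genN j).
Proof.
move=> hj P k /andP[k0 kn].
have n0 : (0 < n)%N by lia.
have P1 := fork_blind1 n0 P.
case: (leqP j 1) => [j1|j1].
  have xj a : (a <= 1)%N -> x * genN j = x * genN a.
    by move=> a1; case: j a j1 a1 {hj} => [|[|//]] [|[|//]] _ _ //; rewrite P1.
  case: (eqVneq k 1%N) => [->|nk].
    rewrite /tail /= wordN_nil !mulr1.
    case: j j1 {hj xj} => [|[|//]] _; first by rewrite -mulrA genN_idem -scalerAr P1 -mulrA genN_idem scalerAr.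
    by rewrite -mulrA (@genN_comm 1 0) // mulrA P1.
  rewrite {1}(xj 0) // (xj 1) // !fork_far //; try lia.
  by rewrite P1.
case: (ltngtP j k) => [jk|kj|jk]; last first.
- subst j; have := P k; rewrite k0 kn => /(_ isT).
  rewrite (tail_top' j1) wordN_cons !mulrA -[x * genN k * genN k]mulrA genN_idem.
  by rewrite -scalerAr -!scalerAl => ->.
- case: (eqVneq j k.+1) => [E|nE].
    have := P k.+1; rewrite -E hj (ltnW j1) => /(_ isT).
    by rewrite E tail_top // wordN_cons !mulrA.
  have c a : (a <= 1)%N -> x * genN j * wordN (tail k 1) * genN a = x * wordN (tail k 1) * genN a * genN j.
    move=> a1; rewrite -[RHS]mulrA -(genN_comm hj) ?mulrA; try lia; last first.
      by rewrite /adjD /edgeD; lia.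
    congr (_ * genN a); rewrite -[LHS]mulrA -[RHS]mulrA; congr (x * _); apply: wordN_comm => //.
      by apply: all_tail.
    by apply/allP => i /tail_ge; rewrite /adjD /edgeD; lia.
  by rewrite !c // P // k0.
have c a : (a <= 1)%N ->
    x * genN j * wordN (tail k 1) * genN a = x * wordN (tail j 1) * genN a * wordN (tail k j.+1).
  move=> a1; rewrite (@tail_split k j.+1) // ?wordN_cat; try lia.
  rewrite tail_top //; last by lia.
  have tj := tail_top' j1.
  have cj : wordN (tail k j.+1) * genN j = genN j * wordN (tail k j.+1).
    have := @tail_far_comm k j.+1 j [:: j] kn; rewrite !wordN1 /= leqnn; apply; lia.
  have cw : wordN (tail k j.+1) * (wordN (tail j 1) * genN a) =
            wordN (tail j 1) * genN a * wordN (tail k j.+1).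
    rewrite -(wordN1 a) -wordN_cat; apply: (@tail_far_comm _ _ j) => //; try lia.
    by rewrite all_cat all_tail //= andbT; lia.
  have br : genN j * genN j.+1 * genN j = genN j.
    by apply: genN_braid; rewrite /adjD /edgeD; lia.
  have key : genN j * (wordN (tail k j.+1) * (genN j.+1 * wordN (tail j 1))) =
             wordN (tail k j.+1) * wordN (tail j 1).
    by rewrite tj wordN_cons !mulrA -cj -[in RHS]br !mulrA.
  have -> : x * wordN (tail j 1) * genN a * wordN (tail k j.+1) =
            x * (wordN (tail k j.+1) * (wordN (tail j 1) * genN a)) by rewrite cw !mulrA.
  by rewrite wordN_cons -[x * genN j * _]mulrA key !mulrA.
by rewrite !c // P //; lia.
Qed.

Lemma fork_blind01 : (0 < n)%N -> fork_blind (genN 0 * genN 1).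
Proof.
move=> n0 k /andP[k0 kn].
have c01 : genN 0 * genN 1 = genN 1 * genN 0 by apply: genN_comm.
case: (eqVneq k 1%N) => [->|nk].
  rewrite /tail /= wordN_nil !mulr1 -[RHS]mulrA genN_idem {1}c01 -mulrA genN_idem.
  by rewrite -!scalerAr c01.
have k1 : (1 < k)%N by lia.
by rewrite fork_far // c01 fork_far.
Qed.

Lemma fork_blind_wordN x w : all (leq^~ n) w -> fork_blind x -> fork_blind (x * wordN w).
Proof.
elim: w x => [|i w IH] x /=; first by rewrite wordN_nil mulr1.
by move=> /andP[hi hw] P; rewrite wordN_cons mulrA; apply: IH => //; apply: fork_blind_mulr.
Qed.

(** After a first factor E_0 E_1, a second one is equal to E_1 E_1 = -[2] E_1. *)
Lemma fork_absorb a b p r : (0 < n)%N -> all (leq^~ n) (b ++ p) ->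
  wordN ((a ++ [:: 0; 1] ++ b) ++ (p ++ [:: 0; 1] ++ r)) =
  loopv *: wordN ((a ++ [:: 0; 1] ++ b) ++ (p ++ [:: 1] ++ r)).
Proof.
move=> n0 hbp; have P : fork_blind (wordN ((a ++ [:: 0; 1] ++ b) ++ p)).
  rewrite -!catA wordN_cat; apply: fork_blind_mull.
  rewrite wordN_cat wordN_cons wordN1; apply: fork_blind_wordN => //; exact: fork_blind01.
move/fork_blind1: P => /(_ n0); set s := a ++ _ => P.
rewrite !(catA s) 2!(wordN_cat (s ++ p)) 2!wordN_cons mulrA P -mulrA [genN 1 * (genN 1 * _)]mulrA genN_idem.
by rewrite -scalerAl -scalerAr.
Qed.

(** A rewriting that produces a scalar must shorten the word: a reduced word can
    then only be rewritten without scalar into a word of the same length. *)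
Definition reduces (w v : seq nat) : Prop :=
  exists2 e, wordN w = loopv ^+ e *: wordN v & (size v + e <= size w)%N.

Lemma red_eq w v : wordN w = wordN v -> (size v <= size w)%N -> reduces w v.
Proof. by move=> E h; exists 0%N; rewrite ?addn0 // expr0 scale1r. Qed.

Lemma red_loop w v : wordN w = loopv *: wordN v -> (size v < size w)%N -> reduces w v.
Proof. by move=> E h; exists 1%N; rewrite ?addn1 // expr1. Qed.

Lemma red_refl w : reduces w w. Proof. exact: red_eq. Qed.

Lemma red_trans v w u : reduces w v -> reduces v u -> reduces w u.
Proof.
move=> [e1 E1 h1] [e2 E2 h2]; exists (e1 + e2)%N; last by lia.
by rewrite E1 E2 scalerA exprD.
Qed.

Lemma red_cat w w' v v' : reduces w v -> reduces w' v' -> reduces (w ++ w') (v ++ v').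
Proof.
move=> [e1 E1 h1] [e2 E2 h2]; exists (e1 + e2)%N; last by rewrite !size_cat; lia.
by rewrite !wordN_cat E1 E2 -scalerAl -scalerAr scalerA exprD.
Qed.

Lemma red_catl u w v : reduces w v -> reduces (u ++ w) (u ++ v).
Proof. exact/red_cat/red_refl. Qed.

Lemma red_catr u w v : reduces w v -> reduces (w ++ u) (v ++ u).
Proof. by move/red_cat; apply; apply: red_refl. Qed.

Lemma red_cons i w v : reduces w v -> reduces (i :: w) (i :: v).
Proof. exact: (@red_catl [:: i]). Qed.

Lemma red_idem i w : reduces (i :: i :: w) (i :: w).
Proof. by apply: red_loop => //; rewrite !wordN_cons mulrA genN_idem scalerAl. Qed.

Lemma red_braid i j w : (i <= n)%N -> (j <= n)%N -> adjD i j ->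
  reduces (i :: j :: i :: w) (i :: w).
Proof.
move=> hi hj ad; apply: red_eq; last by rewrite /= ltnW // ltnS leqnSn.
by rewrite !wordN_cons !mulrA genN_braid.
Qed.

Lemma red_comm i u w : (i <= n)%N -> all (leq^~ n) u -> all (fun j => ~~ adjD i j) u ->
  reduces (i :: u ++ w) (u ++ i :: w).
Proof.
move=> hi hu au; apply: red_eq; last by rewrite /= !size_cat /= addnS.
by rewrite wordN_cons !wordN_cat wordN_cons !mulrA wordN_comm.
Qed.

Lemma red_comm' i u w : (i <= n)%N -> all (leq^~ n) u -> all (fun j => ~~ adjD i j) u ->
  reduces (u ++ i :: w) (i :: u ++ w).
Proof.
move=> hi hu au; apply: red_eq; last by rewrite /= !size_cat /= addnS.
by rewrite wordN_cons !wordN_cat wordN_cons !mulrA wordN_comm.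
Qed.

(** The longest tail of level [m]; it acts on diagrams as E_m with an extra
    loop. *)
Fixpoint full_tail (m : nat) : seq nat :=
  match m with
  | 0 => [::]
  | 1 => [:: 0; 1]
  | m'.+1 => m :: full_tail m' ++ [:: m]
  end.

Lemma full_tailS m : (0 < m)%N -> full_tail m.+1 = m.+1 :: full_tail m ++ [:: m.+1].
Proof. by case: m. Qed.

(** Tails of level [m] are the beginnings of the word
    m, ..., 2, 0, 1, 2, ..., m, up to the exchange of 0 and 1: they are
    the reduced words of the minimal representatives of the cosets of a Coxeter
    group of type D by the one of smaller rank.
    The boolean says whether the tail contains 0, 1. *)
Inductive is_tail : nat -> bool -> seq nat -> Prop :=
| TailNil m : is_tail m.+1 false [::]
| TailOne : is_tail 1 false [:: 1]
| TailZero : is_tail 1 false [:: 0]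
| TailFull m : is_tail m.+1 true (full_tail m.+1)
| TailCons m b t : is_tail m b t -> is_tail m.+1 b (m.+1 :: t).

Inductive canonical : nat -> bool -> seq nat -> Prop :=
| CanonicalNil : canonical 0 false [::]
| CanonicalCat m b b' u t : canonical m b u -> is_tail m.+1 b' t -> ~~ (b && b') ->
    canonical m.+1 (b || b') (u ++ t).

Lemma full_tail_le m : all (leq^~ m) (full_tail m).
Proof.
elim: m => // -[|m] // IH; rewrite full_tailS //= all_cat /= !leqnn /= andbT.
by apply: sub_all IH => i /= /leqW.
Qed.

Lemma is_tail_le m b t : is_tail m b t -> all (leq^~ m) t.
Proof.
elim=> {m b t} // [m|m b t _ IH]; first exact: full_tail_le.
by rewrite /= leqnn; apply: sub_all IH => i /= /leqW.
Qed.

Lemma canonical_le m b v : canonical m b v -> all (leq^~ m) v.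
Proof.
elim=> {m b v} // m b b' u t _ IH /is_tail_le ht _; rewrite all_cat ht andbT.
by apply: sub_all IH => i /= /leqW.
Qed.

Lemma canonical_nil m : canonical m false [::].
Proof. by elim: m => [|m IH]; [constructor | apply: (CanonicalCat IH (TailNil m))]. Qed.

Lemma canonical_widen m b u : canonical m b u -> canonical m.+1 b u.
Proof. by move=> h; have := CanonicalCat h (TailNil m); rewrite cats0 andbF orbF; apply. Qed.

Lemma full_tail_fork m : (0 < m <= n)%N -> exists p r,
  full_tail m = p ++ [:: 0; 1] ++ r /\ wordN (p ++ [:: 1] ++ r) = genN m.
Proof.
elim: m => // -[|m] IH hm; first by exists [::], [::]; rewrite wordN1.
have [p [r [E1 E2]]] := IH (ltac:(lia)).
exists (m.+2 :: p), (r ++ [:: m.+2]); split; first by rewrite full_tailS // E1 /= -!catA.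
have -> : ((m.+2 :: p) ++ [:: 1] ++ r ++ [:: m.+2] = m.+2 :: (p ++ [:: 1] ++ r) ++ [:: m.+2])%N.
  by rewrite /= -!catA.
rewrite wordN_cons wordN_cat E2 wordN1 mulrA genN_braid //; try lia.
by rewrite /adjD /edgeD; lia.
Qed.

(** Once 0, 1 is replaced by 1, the letters on both sides of it cancel by braid
    relations and a tail without fork is left. *)
Lemma is_tail_fork m t : (m <= n)%N -> is_tail m true t -> exists p r t',
  [/\ t = p ++ [:: 0; 1] ++ r, is_tail m false t', wordN (p ++ [:: 1] ++ r) = wordN t'
    & (size t' <= size (p ++ [:: 1] ++ r))%N].
Proof.
move=> + h; have [b Eb] : exists b, b = true by exists true.
rewrite -Eb in h; elim: h Eb => {m b t} // [m _ hm | m b t _ IH Eb hm].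
  have [p [r [E1 E2]]] := full_tail_fork (m := m.+1) hm.
  have h : exists2 t', is_tail m.+1 false t' & t' = [:: m.+1].
    case: m {hm E1 E2} => [|m]; first by exists [:: 1%N] => //; constructor.
    by exists [:: m.+2] => //; do 2!constructor.
  have [t' ht' Et'] := h; exists p, r, t'; split=> //; first by rewrite E2 Et' wordN1.
  by rewrite Et' !size_cat /=; lia.
have [p [r [t' [-> h1 h2 h3]]]] := IH Eb (ltnW hm).
exists (m.+1 :: p), r, (m.+1 :: t'); split=> //; first by constructor.
by rewrite /= wordN_cons h2 wordN_cons.
Qed.

Lemma canonical_fork m v : (m <= n)%N -> canonical m true v ->
  exists a r, v = a ++ [:: 0; 1] ++ r.
Proof.
move=> + h; have [b Eb] : exists b, b = true by exists true.
rewrite -Eb in h; elim: h Eb => {m b v} // m b b' u t _ IH ht nb Eb hm.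
case: b b' IH ht nb Eb => [] [] // IH ht _ _.
  by have [a [r ->]] := IH erefl (ltnW hm); exists a, (r ++ t); rewrite -!catA.
have [p [r [t' [-> _ _ _]]]] := is_tail_fork hm ht.
by exists (u ++ p), r; rewrite -!catA.
Qed.

(** The only obstruction is that both factors contain 0, 1; the second fork is
    then absorbed by the first. *)
Lemma red_canonical_cat m b b' u t : (m < n)%N -> canonical m b u -> is_tail m.+1 b' t ->
  exists b'' v, canonical m.+1 b'' v /\ reduces (u ++ t) v.
Proof.
move=> hm hu ht; case: (boolP (b && b')) => [|nb]; last first.
  by exists (b || b'), (u ++ t); split; [constructor | apply: red_refl].
case: b b' hu ht => [] [] // hu ht _; have [a [c Eu]] := canonical_fork (ltnW hm) hu.
have [p [r [t' [Et ht' E s]]]] := is_tail_fork hm ht.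
exists (true || false), (u ++ t'); split; first by constructor.
have hc : all (leq^~ n) (c ++ p).
  have := canonical_le hu; have := is_tail_le ht.
  rewrite Eu Et !all_cat /= => /andP[h1 _] /and3P[_ _ h2].
  by apply/andP; split; [apply: sub_all h2 | apply: sub_all h1] => i /=; lia.
apply: (@red_trans (u ++ (p ++ [:: 1] ++ r))).
  apply: red_loop; last by rewrite Et !size_cat /=; lia.
  by rewrite Eu Et fork_absorb //; lia.
apply: red_catl; exact: red_eq.
Qed.

(** The letters of [r] descend from [m] and cut the ascending half of the full
    tail by braid relations. *)
Lemma red_full_tail m b r : (m < n)%N -> is_tail m b r -> ~~ b ->
  exists2 t, is_tail m.+1 true t & reduces (full_tail m.+1 ++ r) t.
Proof.
move=> + h; elim: h => {m b r} // [m | | | m b r ht IH] hm nb.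
- by exists (full_tail m.+2); [constructor | rewrite cats0; apply: red_refl].
- exists [:: 2; 0; 1]; first exact: (TailCons (TailFull 0)).
  by apply: (@red_catl [:: 2; 0] [:: 1; 2; 1] [:: 1]); apply: red_braid => //; lia.
- exists [:: 2; 0; 1]; first exact: (TailCons (TailFull 0)).
  apply: (@red_trans [:: 2; 1; 0; 2; 0]).
    apply: (@red_catl [:: 2] [:: 0; 1; 2; 0] [:: 1; 0; 2; 0]).
    by apply: (@red_comm 0 [:: 1] [:: 2; 0]) => //=; lia.
  apply: (@red_trans [:: 2; 1; 0]).
    by apply: (@red_catl [:: 2; 1] [:: 0; 2; 0] [:: 0]); apply: red_braid => //; lia.
  by apply: (@red_catl [:: 2] [:: 1; 0] [:: 0; 1]); apply: (@red_comm 1 [:: 0] [::]) => //; lia.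
case: m ht IH hm => [|m] ht IH hm; first by inversion ht.
have [t' ht' E] := IH (ltnW hm) nb.
exists (m.+3 :: t'); first by constructor.
apply: (@red_trans (m.+3 :: full_tail m.+2 ++ r)); last exact: red_cons.
rewrite full_tailS // (@full_tailS m.+1) //=; apply: red_cons; apply: red_cons.
rewrite -!catA; apply: red_catl; apply: red_braid; try lia.
by rewrite /adjD /edgeD; lia.
Qed.

Lemma norm_step1 i b u b' t : (0 < n)%N -> (i <= 1)%N ->
  canonical 0 b u -> is_tail 1 b' t ->
  exists b'' v, canonical 1 b'' v /\ reduces (i :: u ++ t) v.
Proof.
move=> n0 i1 hu ht; have {hu}-> : u = [::] by inversion hu.
have C c s : is_tail 1 c s -> canonical 1 c s.
  by move=> h; exact: (CanonicalCat CanonicalNil h).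
have A0 : reduces [:: 1; 0] [:: 0; 1] by apply: (@red_comm 1 [:: 0] [::]).
have T01 := C _ _ (TailFull 0).
have {ht} : t \in [:: [::]; [:: 1]; [:: 0]; [:: 0; 1]].
  by inversion ht; subst; rewrite ?inE ?eqxx ?orbT //;
  match goal with H : is_tail 0 _ _ |- _ => inversion H end.
have {i i1} /orP[/eqP->|/eqP->] : (i == 0) || (i == 1) by case: i i1 => [|[]].
  rewrite !inE => /or4P[] /eqP -> /=.
  - by exists false, [:: 0]; split; [apply: C; constructor | apply: red_refl].
  - by exists true, [:: 0; 1]; split; [ | apply: red_refl].
  - by exists false, [:: 0]; split; [apply: C; constructor | apply: red_idem].
  - by exists true, [:: 0; 1]; split; [ | apply: red_idem].
rewrite !inE => /or4P[] /eqP -> /=.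
- by exists false, [:: 1]; split; [apply: C; constructor | apply: red_refl].
- by exists false, [:: 1]; split; [apply: C; constructor | apply: red_idem].
- by exists true, [:: 0; 1].
- exists true, [:: 0; 1]; split=> //; apply: (@red_trans [:: 0; 1; 1]).
    exact: (@red_catr [:: 1] [:: 1; 0] [:: 0; 1]).
  exact: (@red_catl [:: 0] [:: 1; 1] [:: 1] (red_idem _ _)).
Qed.

Definition normalizable m := forall w, all (leq^~ m) w ->
  exists b v, canonical m b v /\ reduces w v.

(** The new letter [i] exceeds the letters of [u] by at least 2 and is moved
    next to [t']. If [t] is empty then [i :: t'] is a tail; otherwise [t] starts
    with [i] as well, and the two letters [i] merge by an idempotent or a braid
    relation, unless [t'] is a full tail, when a longer full tail appears and
    [red_full_tail] applies. *)
Lemma norm_top m b1 u b2 t' b t (i := m.+2) : (i <= n)%N -> normalizable m.+1 ->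
  canonical m b1 u -> is_tail m.+1 b2 t' -> ~~ (b1 && b2) -> is_tail m.+2 b t ->
  ~~ ((b1 || b2) && b) ->
  exists b'' v, canonical m.+2 b'' v /\ reduces (i :: (u ++ t') ++ t) v.
Proof.
move=> hi norm hu ht' nb ht nb'.
have iu : reduces (i :: (u ++ t') ++ t) (u ++ i :: t' ++ t).
  rewrite -catA; apply: red_comm => //.
    by apply: sub_all (canonical_le hu) => j /=; rewrite /i in hi *; lia.
  have := canonical_le hu; rewrite /i; case: (m) (hu) => [|m'] hu' ha; first by inversion hu'.
  by apply: sub_all ha => j /=; rewrite /adjD /edgeD; lia.
suff [b'' [v [hv r]]] : exists b'' v, canonical m.+2 b'' v /\ reduces (u ++ i :: t' ++ t) v.
  by exists b'', v; split=> //; apply: red_trans iu r.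
have hi' : (m.+1 <= n)%N by rewrite ltnW.
have hu1 := canonical_widen hu.
have empty c s : is_tail m.+2 c s -> ~~ (b1 && c) -> canonical m.+2 (b1 || c) (u ++ s).
  by move=> hs hc; exact: CanonicalCat hu1 hs hc.
case: (eqVneq t [::]) => [Et|nt].
  rewrite Et cats0; exists (b1 || b2), (u ++ i :: t'); split; last exact: red_refl.
  by apply: empty => //; constructor.
have [r Et] : exists r, t = i :: r.
  by move: nt; inversion ht => //; subst; [rewrite full_tailS //; eexists | eexists].
case: (eqVneq t' [::]) => [Et'|nt'].
  exists (b1 || b), (u ++ t); split.
    by apply: empty => //; move: nb'; case: (b1) (b2) (b) => [] [] [].
  by apply: red_catl; rewrite Et' Et; apply: red_idem.
case: (boolP (b2 && (t' == full_tail m.+1))) => [/andP[Eb2 /eqP Et']|nf].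
  have Eb : b = false by move: nb'; rewrite Eb2 orbT /=; case: (b).
  have Eb1 : b1 = false by move: nb; rewrite Eb2 andbT; case: (b1).
  have hr : is_tail m.+1 false r.
    by move: ht; rewrite Eb Et => ht; inversion ht; subst.
  have [t2 ht2 r2] := red_full_tail hi hr isT.
  exists (b1 || true), (u ++ t2); split; first by apply: empty; rewrite ?Eb1.
  by apply: red_catl; rewrite Et' Et; rewrite full_tailS //= -catA in r2 *.
have [a [s [Et2 ha hs hms had]]] : exists a s, [/\ t' = a :: s, (a <= m.+1)%N,
   all (leq^~ m) s, (m == 0) ==> (s == [::]) & adjD i a].
  clear -ht' nt' nf; rewrite /i; inversion ht'; subst => //.
  - by exists 1, [::].
  - by exists 0, [::].
  - by rewrite eqxx in nf.
  match goal with H : is_tail m b2 ?s |- _ => have hs := H; exists m.+1, s end.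
  split=> //; first exact: is_tail_le hs.
    by case: (m) hs => // hs; inversion hs.
  by rewrite /adjD /edgeD; lia.
have hs1 : all (leq^~ n) s by apply: sub_all hs => j /= hj; apply: leq_trans hj (ltnW hi').
have as1 : all (fun j => ~~ adjD i j) s.
  rewrite /i; move: hs hms; case: (m) => [|m'] hs hms; first by rewrite (eqP hms).
  by apply: sub_all hs => j /=; rewrite /adjD /edgeD; lia.
have r1 : reduces (i :: t' ++ t) (s ++ t).
  rewrite Et2 Et /=; apply: (@red_trans (i :: a :: i :: s ++ r)).
    by apply: red_cons; apply: red_cons; apply: red_comm'.
  apply: (@red_trans (i :: s ++ r)); last exact: red_comm.
  by apply: red_braid => //; apply: leq_trans ha hi'.
have [b3 [u' [hu' r3]]] : exists b3 u', canonical m.+1 b3 u' /\ reduces (u ++ s) u'.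
  by apply: norm; rewrite all_cat; apply/andP; split;
     [apply: sub_all (canonical_le hu) | apply: sub_all hs] => j /= /leqW.
have [b4 [v [hv r4]]] := red_canonical_cat hi hu' ht.
exists b4, v; split=> //; apply: (@red_trans (u ++ (s ++ t))); first exact: red_catl.
by rewrite catA; apply: red_trans r4; apply: red_catr.
Qed.

(** Words are built from the right; a letter below the top level is absorbed by
    the normal form of the smaller level. *)
Theorem red_canonical m : (m < n)%N -> normalizable m.+1.
Proof.
elim: m => [|m IH] hm; (elim=> [_|i w IHw /= /andP[hi hw]];
  [by exists false, [::]; split; [apply: canonical_nil | apply: red_refl]|]);
  have [b [v [hv r]]] := IHw hw; inversion hv as [|m' b1 b2 u t hu ht nb Em Eb Ev]; subst.
  have [b'' [v [hv' r']]] := norm_step1 hm hi hu ht.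
  by exists b'', v; split=> //; apply: red_trans r'; apply: red_cons.
suff [b'' [v [hv' r']]] : exists b'' v, canonical m.+2 b'' v /\ reduces (i :: u ++ t) v.
  by exists b'', v; split=> //; apply: red_trans r'; apply: red_cons.
have norm := IH (ltnW hm).
move: hi; rewrite leq_eqVlt ltnS => /orP[/eqP -> | hi].
  inversion hu as [|m' b1' b2' u' t' hu' ht' nb' Em Eb Ev]; subst.
  exact: norm_top hm norm hu' ht' nb' ht nb.
have [b3 [u' [hu' r3]]] : exists b3 u', canonical m.+1 b3 u' /\ reduces (i :: u) u'.
  by apply: norm; rewrite /= hi; apply: canonical_le hu.
have [b4 [v [hv' r4]]] := red_canonical_cat hm hu' ht.
by exists b4, v; split=> //; apply: red_trans r4; rewrite -cat_cons; apply: red_catr.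
Qed.

End NormalForm.

(** * The action of canonical words *)
Section CanonicalAction.
Variables (K : fieldType) (q : K).
Notation loopv := (- qint q 2).
Notation act := (word_mx q).
Notation gen_mx := (gen_mx q).
Notation ins_mx := (ins_mx K).

Lemma act_full_tail n m : (0 < m <= n)%N ->
  act n false (full_tail m) = loopv *: gen_mx n false m.
Proof.
elim: m => // -[_ hn|m IH /andP[_ hm]].
  rewrite !act_cons act_nil mulmx1 -(@gen_mx_idem _ q n false 1%N) //.
have n0 : (0 < n)%N by lia.
rewrite full_tailS // act_cons act_cat act_cons act_nil mulmx1 IH; last by lia.
rewrite -scalemxAl -scalemxAr mulmxA gen_mx_braid //; try lia.
by rewrite /adjD /edgeD; lia.
Qed.

Lemma act_is_tail n m b t : (m <= n)%N -> is_tail m b t ->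
  exists2 k, (k <= m)%N & act n false t = loopv ^+ b *: act n false (tail m k).
Proof.
move=> + h; elim: h => {m b t} [m | | | m | m b t _ IH] hn.
- by exists m.+1 => //; rewrite /tail subnn expr0 scale1r.
- by exists 0%N => //; rewrite expr0 scale1r.
- by exists 0%N => //; rewrite expr0 scale1r !act_cons.
- exists m => //; rewrite act_full_tail // expr1 tailS // /tail subnn /=.
  by rewrite act_cons act_nil mulmx1.
have [k hk E] := IH (ltnW hn); exists k; first by lia.
have -> : tail m.+1 k = m.+1 :: tail m k.
  rewrite /tail subSn // -[(m - k).+1]addn1 iotaD rev_cat /=.
  by rewrite (_ : k.+1 + (m - k) = m.+1)%N //; lia.
by rewrite !act_cons E -scalemxAr.
Qed.

(** In the type A action a tail without fork inserts a chord and closes no loop,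
    and the fork gives E_1 E_1 = -[2] E_1, that is, one loop. *)
Lemma act_canonical n b v : canonical n b v -> (0 < n)%N ->
  exists2 c, valid c & act n false v *m ket (id_state n.+1) = loopv ^+ b *: ket c.
Proof.
elim=> {n b v} // n b b' u t hu IH ht nb _.
have [k hk Et] := act_is_tail (leqnn _) ht.
have v0 := id_state_valid n.+1.
rewrite act_cat Et -mulmxA -scalemxAl act_tail // -scalemxAr -ins_mx_ket // mulmxA.
case: n u hu IH {ht Et} k hk v0 => [|n] u hu IH k hk v0.
  have [-> ->] : u = [::] /\ b = false by inversion hu.
  exists (ins k (id_state 1)); first by rewrite ins_valid //; lia.
  by rewrite act_nil mul1mx ins_mx_ket.
have [c vc E] := IH isT.
exists (ins k c); first by rewrite ins_valid //; lia.
rewrite act_ins //; last by apply: canonical_le hu.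
rewrite -mulmxA E -scalemxAr scalerA -exprD ins_mx_ket //.
by congr (_ ^+ _ *: _); case: (b) (b') nb => [] [].
Qed.

Lemma act_canonical_odd n v : (0 < n)%N -> canonical n true v -> act n true v = 0.
Proof.
move=> n0 hv; have [a [r ->]] := @canonical_fork K q n n v (leqnn n) hv.
rewrite !act_cat !act_cons act_nil mulmx1.
have ab : top_pt n 0 != top_pt n 1 by rewrite top_pt_eq; lia.
have -> : gen_mx n true 0 *m gen_mx n true 1 = 0 := surg_mx_dotted loopv true ab.
by rewrite mul0mx mulmx0.
Qed.

End CanonicalAction.

(** * Loops closed by reduced words *)
Section Words.
Variables (K : fieldType) (q : K) (n : nat).
Hypothesis n0 : (0 < n)%N.
Notation loopv := (- qint q 2).
Notation act := (word_mx q).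
Notation gen_mx := (gen_mx q).

Lemma strip_valid (T : finType) (c : state T) : valid c -> valid (strip c).
Proof.
move=> v; apply/forallP => x; rewrite !ffunE /=.
by have /forallP/(_ x)/andP[-> /eqP ->] := v; rewrite eqxx.
Qed.

Lemma surg_strip (T : finType) (c : state T) a b e : valid c ->
  surg a b false (strip c) = strip (surg a b e c).
Proof.
move=> v; apply/ffunP => x; rewrite (surgE _ _ _ _ (strip_valid v)) [RHS]ffunE (surgE _ _ _ _ v).
rewrite !ffunE /=.
by do 4!case: ifP => // _.
Qed.

(** [L] counts the loops closed while the word is stacked and [d] those that
    carry a dot; in the action that keeps the dots, the latter count 0. *)
Lemma word_state (w : seq 'I_n.+1) (D := word_stack w) :
  [/\ valid (signed D), D.2 \subset chord D.1 & exists L d : nat,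
    [/\ act n false (map val w) *m ket (id_state n.+1) = loopv ^+ L *: ket (strip (signed D)),
        d = 0%N -> act n true (map val w) *m ket (id_state n.+1) = loopv ^+ L *: ket (signed D),
        odd #|D.2| = odd d & (d <= L)%N]].
Proof.
rewrite {}/D; elim: w => [|i w [v sub [L [d [E1 E2 od dL]]]]].
  have E : signed (id_pairing n.+1, set0) = id_state n.+1.
    by apply/ffunP => x; rewrite !ffunE /= !inE.
  have E' : strip (id_state n.+1) = id_state n.+1.
    by apply/ffunP => x; rewrite !ffunE.
  rewrite /= E; split; [exact: id_state_valid | by apply/subsetP => x; rewrite inE|].
  by exists 0%N, 0%N; split; rewrite ?E' ?act_nil ?mul1mx ?expr0 ?scale1r ?cards0.
have hi : (i <= n)%N by rewrite -ltnS.
have -> : word_stack (i :: w) = stack (gen_diagram n i) (word_stack w) by [].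
set D := word_stack w in v sub E1 E2 od *.
have Es := signed_stack n0 hi v; set S := surg _ _ _ _ in Es.
have nt := neq_tt' n0 hi.
have vS : valid (signed (stack (gen_diagram n i) D)).
  by rewrite Es /S; apply: surg_valid.
have sub' := stack_dots_chord i D.
set t := top_pt n i.-1 in nt S Es *; set t' := top_pt n i.-1.+1 in nt S Es *.
set e := (_ == _) in S Es.
pose lp : bool := (signed D t).1 == t'.
pose dt : bool := lp && ((signed D t).2 != e).
have od' := odd_labels_surg v nt (double_card_dots v sub).
have {od'} := od' e #|(stack (gen_diagram n i) D).2|.
rewrite -/S -Es => /(_ (double_card_dots vS sub')) od'.
split=> //; exists (L + lp)%N, (d + dt)%N; split.
- rewrite map_cons act_cons -mulmxA E1 -scalemxAr monomial_ket scalerA.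
  rewrite (surg_strip _ _ e v) -/S -Es exprD; congr (_ * _ *: _).
  rewrite /loop_weight strip_valid //= !ffunE /= -signedE -/t -/t' -/lp.
  by case: (lp); rewrite ?expr1 ?expr0 ?eqxx.
- move/eqP; rewrite addn_eq0 => /andP[/eqP d0 ndt].
  rewrite map_cons act_cons -mulmxA E2 // -scalemxAr monomial_ket scalerA andTb.
  rewrite -/e -/t -/t' -/S -Es exprD; congr (_ * _ *: _).
  rewrite /loop_weight v /= -/lp; move: ndt; rewrite /dt.
  case: (lp) => [|_] /=; last by rewrite expr0.
  by case: ((signed D t).2 == e) => // _; rewrite expr1.
- by rewrite od' od oddD; congr (_ (+) _); rewrite -/lp -/dt; case: (dt).
- by rewrite leq_add // /dt; case: (lp) => //=; case: (_ != _).
Qed.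

End Words.

Definition plain (N : nat) (C : pairing N) : state 'I_N.*2 := [ffun x => (C x, false)].

Lemma strip_signed N (D : dotted_pairing N) : strip (signed D) = plain D.1.
Proof. by apply/ffunP => x; rewrite !ffunE. Qed.

Lemma plain_inj N : injective (@plain N).
Proof.
by move=> C C' /ffunP h; apply/ffunP => x; have := h x; rewrite !ffunE => -[].
Qed.

Lemma card_first_chord n : #|first_chord n.+1| = 1%N.
Proof.
rewrite (_ : first_chord n.+1 = [set (ord0 : 'I_n.+1.*2)]) ?cards1 //.
by apply/setP => x; rewrite !inE.
Qed.

Lemma id_typeD N : typeD (id_pairing N, set0).
Proof.
apply/and3P; split; last by rewrite cards0 /=; apply/orP; left; apply/forallP => x; rewrite inE.
  apply/andP; split; apply/forallP => x.
    by rewrite !ffunE rev_ordK eqxx andbT -val_eqE /=; have := ltn_ord x; lia.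
  by apply/forallP => y; rewrite !ffunE /=; lia.
by apply/subsetP => x; rewrite inE.
Qed.

Definition id_diagram N : diagram N := Sub (id_pairing N, set0) (id_typeD N).

Section Coefficients.
Variables (K : fieldType) (q : K).
Notation loopv := (- qint q 2).
Notation act := (word_mx q).
Notation gen_mx := (gen_mx q).

Lemma wordN_word n (w : seq 'I_n.+1) : wordN q n (map val w) = word_elt q w.
Proof. by rewrite /wordN big_map; apply: eq_bigr => i _; rewrite /genN inord_val. Qed.

Lemma word_wordN n v : all (leq^~ n) v ->
  wordN q n v = word_elt q (map inord v : seq 'I_n.+1).
Proof.
move=> hv; rewrite -wordN_word; congr (wordN _ _ _); rewrite -map_comp -[LHS]map_id.
by apply/eq_in_map => i /(allP hv) hi; rewrite /= inordK.
Qed.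

Lemma rho_wordN n e v : (0 < n)%N -> all (leq^~ n) v -> rho e (wordN q n v) = act n e v.
Proof.
move=> n0 hv; rewrite word_wordN // rho_word //; congr (word_mx _ _ _ _).
by rewrite -map_comp -[RHS]map_id; apply/eq_in_map => i /(allP hv) hi; rewrite /= inordK.
Qed.

Hypothesis qint_neq0 : forall m, qint q m.+1 != 0.
Hypothesis loop_inj : injective (fun L : nat => loopv ^+ L).

(** The word equals a canonical one in the algebra, so at most one loop is
    closed. If there is one, the canonical word acts as 0 in the action that
    keeps the dots, and the loop must be dotted. *)
Lemma reduced_act n (w : seq 'I_n.+1) (D := word_stack w) : (0 < n)%N -> reduced q w ->
  act n false (map val w) *m ket (id_state n.+1) =
  loopv ^+ (odd #|D.2|) *: ket (strip (signed D)).
Proof.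
move=> n0 rw; have [v _ [L [d [E1 E2 od dL]]]] := word_state q n0 w.
have hw : all (leq^~ n.-1.+1) (map val w).
  by apply/allP => i /mapP[j _ ->]; rewrite /= prednK // -ltnS; apply: ltn_ord.
have [b [u [hu [e Eu su]]]] := red_canonical q (n := n)
  (m := n.-1) (ltac:(lia)) hw.
rewrite prednK // in hu; have hu' := canonical_le hu.
have e0 : e = 0%N.
  case: (posnP e) => // e0; exfalso.
  have hs : (size (map inord u : seq 'I_n.+1) < size w)%N.
    rewrite size_map; move: su; rewrite size_map => su.
    by apply: leq_trans su; rewrite -addn1 leq_add2l.
  by apply: (rw (loopv ^+ e) _ hs); rewrite -word_wordN // -wordN_word.
move: Eu; rewrite e0 expr0 scale1r => Eu.
have act_eq f : act n f (map val w) = act n f u.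
  by rewrite -!rho_wordN ?Eu //; move: hw; rewrite prednK.
have l0 L' : loopv ^+ L' != 0 by rewrite expf_neq0 // oppr_eq0 qint_neq0.
have [c vc Ec] := act_canonical q hu n0.
have := E1; rewrite act_eq Ec => /(ket_scale_inj (l0 _)) [_ /loop_inj bL].
rewrite -Ec -act_eq E1 -/D; congr (_ ^+ _ *: _); rewrite od.
case: (b) hu bL => hu bL; last by move: dL; rewrite -bL leqn0 => /eqP ->.
have dn0 : d != 0%N.
  apply/eqP => /E2; rewrite act_eq act_canonical_odd // mul0mx => /esym/eqP.
  by rewrite scaler_eq0 (negbTE (l0 _)) (negbTE (ket_neq0 _ _)).
by rewrite -bL in dL *; case: d dn0 dL {E2 od} => [|[]].
Qed.

Variable b : forall n, diagram n.+1 -> TLD q n.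
Hypothesis hb : is_diagram_basis b.

Lemma word_diagram_conn n (w : seq 'I_n.+1) (D : diagram n.+1) :
  word_diagram w = val D ->
  conn D = (word_stack w).1 /\ odd (ndots D) = odd #|(word_stack w).2|.
Proof.
rewrite /word_diagram /conn /ndots; case: (word_stack w) => C dots <- /=; split=> //.
by case: ifP; rewrite ?card_first_chord.
Qed.

Lemma basis_act n (D : diagram n.+1) : (0 < n)%N ->
  rho false (b D) *m ket (id_state n.+1) = loopv ^+ odd (ndots D) *: ket (plain (conn D)).
Proof.
move=> n0; have [w [rw ww ->]] := hb n0 D; have [-> ->] := word_diagram_conn ww.
by rewrite rho_word // reduced_act // strip_signed.
Qed.

Lemma word_stack_id n (w : seq 'I_n.+1) : (0 < n)%N ->
  (word_stack w).1 = id_pairing n.+1 -> w = [::].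
Proof.
move=> n0; case: w => // i w.
have hi : (i <= n)%N by rewrite -ltnS.
have [v _ _] := word_state q n0 w.
have -> : word_stack (i :: w) = stack (gen_diagram n i) (word_stack w) by [].
move=> E; have /ffunP/(_ (top_pt n i.-1)) := signed_stack n0 hi v.
rewrite (surg_signed i v) eqxx ffunE E ffunE.
move=> /(congr1 fst) h; have {h} : rev_ord (top_pt n i.-1) = top_pt n i.-1.+1 := h.
move=> /(congr1 (@nat_of_ord _)); rewrite (val_t' n0 hi) val_rev (val_t n0 hi).
lia.
Qed.

Lemma basis_id n : (0 < n)%N -> b (id_diagram n.+1) = 1.
Proof.
move=> n0; have [w [rw ww ->]] := hb n0 (id_diagram n.+1).
have [E _] := word_diagram_conn ww.
have -> : w = [::] by apply: word_stack_id => //; rewrite -E.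
by rewrite /word_elt big_nil.
Qed.

(** The last letter of the word is singled out because it acts first on vectors. *)
Lemma basis_not_id n (D : diagram n.+1) : (0 < n)%N -> D != id_diagram n.+1 ->
  exists i w, b D = word_elt q (rcons w i).
Proof.
move=> n0 nD; have [w [rw ww ->]] := hb n0 D.
case/lastP: w ww {rw} => [ww|w i _]; last by exists i, w.
case/eqP: nD; apply: val_inj; rewrite -ww /word_diagram /= cards0 //.
Qed.

Lemma eval_gen n (s : expr K n) : eval (@gen K q n) s = \pi_(TLD q n) s.
Proof.
elim: s => //= [s ->|s -> t ->|s -> t ->|c s ->];
  by apply: TLD_eq; apply/expr_eqP => A E hE /=; rewrite ?(eval_repr _ hE).
Qed.

Lemma TLD_incl_id n (h : (n <= n)%N) (x : TLD q n) : TLD_incl h x = x.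
Proof.
rewrite /TLD_incl /TLD_lift -[RHS]reprK -eval_gen.
elim: (repr x) => //= [i|s ->|s -> t ->|s -> t ->|c s ->] //.
by congr gen; apply: val_inj.
Qed.

Variable Q : forall n, TLD q n.
Hypothesis hQ : is_projection Q.
Variable coef : forall n, diagram n.+1 -> K.
Hypothesis hcoef : is_coef Q b coef.

Lemma word_rcons_proj n (w : seq 'I_n.+1) i : word_elt q (rcons w i) * Q n = 0.
Proof.
have [_ _ h] := hQ n; have [h1 _] := h i.
by rewrite /word_elt -cats1 big_cat big_seq1 /= -mulrA h1 mulr0.
Qed.

(** From Q_n Q_n = Q_n, since the other basis elements kill Q_n. *)
Lemma coef_id n : (0 < n)%N -> coef (id_diagram n.+1) = 1.
Proof.
move=> n0; have [Q0 hi _] := hQ n; have [+ _] := hi ord_max.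
rewrite (TLD_incl_id (leq_ord (@ord_max n))) {1}(hcoef.2 n n0) mulr_suml.
rewrite (bigD1 (id_diagram n.+1)) //= big1 ?addr0 => [|D nD]; last first.
  have [i [w ->]] := basis_not_id n0 nD.
  by rewrite -scalerAl word_rcons_proj scaler0.
rewrite basis_id // -scalerAl mul1r => E.
apply/eqP; rewrite -subr_eq0; apply/eqP.
have /eqP : (coef (id_diagram n.+1) - 1) *: Q n = 0.
  by rewrite scalerBl E scale1r subrr.
by rewrite scaler_eq0 => /orP[/eqP //|/eqP].
Qed.

(** Q_n is the identity plus nonempty words, which kill the vector. *)
Lemma proj_fix n (y : 'cV[K]_#|state 'I_n.+1.*2|.+1) : (0 < n)%N ->
  (forall i : 'I_n.+1, gen_mx n false i *m y = 0) -> rho false (Q n) *m y = y.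
Proof.
move=> n0 killed; rewrite (hcoef.2 n n0) rho_sum // mulmx_suml.
rewrite (bigD1 (id_diagram n.+1)) //= big1 ?addr0 => [|D nD]; last first.
  have [i [w ->]] := basis_not_id n0 nD.
  rewrite rhoZ // rho_word // map_rcons -cats1 act_cat act_cons act_nil mulmx1.
  by rewrite -scalemxAl -mulmxA killed mulmx0 scaler0.
by rewrite rhoZ // basis_id // rho1 // coef_id // scale1r mul1mx.
Qed.

End Coefficients.

(** * Coordinates on connectivities *)
Section Removal.
Variable N : nat.

Lemma plain_valid M (C : pairing M) : connectivity C -> valid (plain C).
Proof.
case/andP => /forallP h _; apply/forallP => x; rewrite !ffunE /=.
by have /andP[-> /eqP ->] := h x; rewrite eqxx.
Qed.

Lemma ins_inj k : (k <= N.*2)%N -> injective (@ins N k).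
Proof.
move=> hk c c' /ffunP E; apply/ffunP => x; have := E (shift k x).
rewrite !ins_shift // => -[/shift_inj E1 E2].
by rewrite [LHS]surjective_pairing E1 E2 -surjective_pairing.
Qed.

Lemma ins_remove_cap (C : pairing N.+1) (i : 'I_N.+1) : connectivity C ->
  innermost C i -> ins i (plain (remove_cap C i)) = plain C.
Proof.
move=> hC /eqP hi; have v := plain_valid hC.
have iN : (i <= N.*2)%N by have := ltn_ord i; lia.
have CC x : C (C x) = x by have := validK x v; rewrite !ffunE /= => -[].
apply/ffunP => x; case: (shiftP x iN) => [->|->|y ->].
- by rewrite insL ffunE hi.
- by rewrite insR // ffunE -hi CC.
rewrite ins_shift // !ffunE /=; congr (_, _); rewrite -/(shift i y).
case: (shiftP (C (shift i y)) iN) => [E|E|z E].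
- have [_] := shift_neq y iN; rewrite -hi -E CC eqxx //.
- by have [+ _] := shift_neq y iN; rewrite -{1}[shift i y]CC E -hi CC eqxx.
rewrite E; congr (shift i _); apply: val_inj.
rewrite val_shift (_ : delete_pt _ _ = z); first by rewrite val_insubd ltn_ord.
by rewrite /delete_pt /insert_pt; case: (ltnP z i) => h; [rewrite h | case: ifP; lia].
Qed.

Lemma ins_plain (C : pairing N.+1) (i : 'I_N.+1) s :
  ins i s = plain C -> innermost C i.
Proof.
move/ffunP/(_ (inord i)); rewrite insL ffunE => E.
by rewrite /innermost -[C _]/((C (inord i), false).1) -E.
Qed.

End Removal.

Section Coordinates.
Variables (K : fieldType) (q : K).
Notation loopv := (- qint q 2).

Lemma monomial_coord (S S' : finType) (f : S -> S') (g : S -> K) (v : 'cV[K]_#|S|.+1) t :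
  (monomial f g *m v) (ket_index t) 0 = \sum_(s | f s == t) g s * v (ket_index s) 0.
Proof.
rewrite monomial.unlock mulmx_suml summxE [RHS]big_mkcond; apply: eq_bigr => s _.
rewrite -scalemxAl mxE mxE (bigD1 (ket_index s)) //= big1 ?addr0 => [|j nj].
  rewrite mxE eqxx andbT (inj_eq (@ket_index_inj S')) eq_sym.
  by case: eqP => _; rewrite ?mul1r // mul0r mulr0.
by rewrite mxE (negbTE nj) andbF mul0r.
Qed.

Lemma ins_mx_coord N (C : pairing N.+1) (i : 'I_N.+1) (v : 'cV[K]_#|state 'I_N.*2|.+1) : connectivity C ->
  (ins_mx K N i *m v) (ket_index (plain C)) 0 =
  if innermost C i then v (ket_index (plain (remove_cap C i))) 0 else 0.
Proof.
move=> hC; have iN : (i <= N.*2)%N by have := ltn_ord i; lia.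
rewrite monomial_coord; case: ifP => hi; last first.
  by rewrite big1 // => s /eqP /ins_plain; rewrite hi.
have E := ins_remove_cap hC hi.
rewrite (big_pred1 (plain (remove_cap C i))) => [|s]; last first.
  by rewrite -E (inj_eq (ins_inj iN)).
by rewrite -(ins_valid _ iN) E plain_valid // mul1r.
Qed.

Variable coef : forall n, diagram n.+1 -> K.

Lemma odd_dots N (D : diagram N) : odd (ndots D) -> (val D).2 = first_chord N.
Proof.
rewrite /ndots; case: D => -[C dots] /= /and3P[_ _ h] od.
by move: h; rewrite od /= => /andP[/eqP].
Qed.

(** A diagram with an odd number of dots has exactly one dot, on the first chord,
    so it is determined by its connectivity. *)
Lemma a_coefE n (C : pairing n.+1) : a_coef q coef C =
  \sum_(D | conn D == C) loopv ^+ odd (ndots D) * coef D.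
Proof.
rewrite (bigID (fun D => ~~ odd (ndots D))) /a_coef /=; congr (_ + _).
  by apply: eq_bigr => D /andP[_ /negbTE ->]; rewrite expr0 mul1r.
rewrite /odd_diagram; case: pickP => [D0 /andP[/eqP C0 /eqP n0]|none].
  rewrite (big_pred1 D0) => [|D]; first by rewrite n0 expr1 mulNr.
  rewrite negbK /=; apply/andP/eqP => [[/eqP CD od]|->]; last by rewrite n0 C0.
  apply: val_inj; rewrite [LHS]surjective_pairing [RHS]surjective_pairing.
  rewrite (odd_dots od) (odd_dots (D := D0)) ?n0 //; congr (_, _).
  by rewrite -/(conn D) -/(conn D0) CD C0.
rewrite mulr0 oppr0 big1 // => D; rewrite negbK => /andP[CD od].
by have := none D; rewrite CD /ndots (odd_dots od) card_first_chord.
Qed.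

Hypothesis qint_neq0 : forall m, qint q m.+1 != 0.
Hypothesis q_neq0 : q != 0.
Hypothesis q2_neq1 : q - q^-1 != 0.
Hypothesis loop_inj : injective (fun L : nat => loopv ^+ L).
Variable Q : forall n, TLD q n.
Variable b : forall n, diagram n.+1 -> TLD q n.
Hypothesis hQ : is_projection Q.
Hypothesis hb : is_diagram_basis b.
Hypothesis hcoef : is_coef Q b coef.

(** On several strands this sums the action of the basis elements on the
    identity; on one strand the only diagram is the identity. *)
Lemma proj_vec_coord n (C : pairing n.+1) :
  proj_vec Q n.+1 (ket_index (plain C)) 0 = a_coef q coef C.
Proof.
rewrite a_coefE; case: n C => [|n] C.
  rewrite /proj_vec ketE.
  have P : id_state 1 = plain (id_pairing 1) by apply/ffunP => x; rewrite !ffunE.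
  have rev (x y : 'I_1.*2) : y != x -> y = rev_ord x.
    rewrite -val_eqE => /= nx; apply: ord_inj; rewrite val_rev.
    by have := ltn_ord x; have := ltn_ord y; lia.
  have single (D : diagram 1) : ~~ odd (ndots D) /\ D = id_diagram 1.
    have cD : conn D = id_pairing 1.
      have := valP D; rewrite [val D]surjective_pairing => /and3P[+ _ _].
      case/andP => /forallP h _; apply/ffunP => x; rewrite ffunE.
      by have /andP[+ _] := h x; apply: rev.
    have := valP D; rewrite [val D]surjective_pairing -/(conn D) cD => /and3P[_ sub].
    rewrite eqxx andbF orbF => /andP[ev _]; split=> //.
    apply: val_inj; rewrite [LHS]surjective_pairing -/(conn D) cD; congr (_, _).
    have dots0 : (val D).2 \subset [set ord0].
      apply/subsetP => x /(subsetP sub); rewrite unfold_in /chord ffunE inE val_rev -val_eqE.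
      by move=> h; apply/eqP => /=; move: h (ltn_ord x); lia.
    have := subset_leq_card dots0; rewrite cards1; move: ev; case E: #|_| => [|[|]] //.
    by move=> _ _; apply/eqP; rewrite -cards_eq0 E.
  rewrite P (inj_eq (@plain_inj 1)); case: eqP => [->|nC].
    rewrite (big_pred1 (id_diagram 1)) => [|D]; last first.
      by have [_ ->] := single D; rewrite /conn SubK /= !eqxx.
    by have [/negbTE -> _] := single (id_diagram 1); rewrite hcoef.1 mulr1.
  by rewrite big1 // => D /eqP cD; case: nC; rewrite -cD (single D).2.
rewrite /proj_vec (hcoef.2 n.+1 isT) rho_sum // mulmx_suml summxE [RHS]big_mkcond.
apply: eq_bigr => D _; rewrite rhoZ // -scalemxAl (basis_act _ _ hb) // scalerA mxE ketE.
rewrite (inj_eq (@plain_inj _)) eq_sym; case: eqP => _; rewrite ?mulr1 ?mulr0 //.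
by rewrite mulrC.
Qed.

Theorem a_coef_rec n (C : pairing n.+2) : connectivity C ->
  a_coef q coef C = \sum_(i < n.+2 | innermost C i)
     qint q i.+1 / qint q n.+2 * a_coef q coef (remove_cap C i).
Proof.
move=> hC; have fixQ m y := @proj_fix K q b hb Q hQ coef hcoef m y.
rewrite -proj_vec_coord (proj_vec_rec hQ fixQ qint_neq0 q_neq0 q2_neq1).
rewrite /rec_vec summxE [RHS]big_mkcond; apply: eq_bigr => i _.
rewrite mxE ins_mx_coord //; case: ifP => _; last by rewrite mulr0.
by rewrite proj_vec_coord.
Qed.

End Coordinates.

(** * The quantum parameter *)
Section NotRootOfUnity.
Variables (K : fieldType) (q : K).
Hypotheses (q_neq0 : q != 0) (q_not_root : forall m, (0 < m)%N -> q ^+ m != 1).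
Hypothesis q2_not_root : forall k, (0 < k)%N -> (- (q ^+ 2 + 1)) ^+ k != q ^+ k.

Lemma q_sub_inv : q - q^-1 != 0.
Proof.
rewrite subr_eq0; apply: contra (q_not_root (m := 2) isT) => /eqP E.
by rewrite expr2 {1}E mulVf.
Qed.

Lemma qint_neq0 m : qint q m.+1 != 0.
Proof.
rewrite mulf_neq0 ?invr_eq0 ?q_sub_inv // subr_eq0.
apply: contra (q_not_root (m := m.+1 + m.+1) isT) => /eqP E.
by rewrite exprD {1}E mulVf // expf_neq0.
Qed.

Lemma mul_q_loop : q * (- qint q 2) = - (q ^+ 2 + 1).
Proof.
have := q_sub_inv; rewrite -(mulrI_eq0 _ (mulfI q_neq0)) mulrBr mulfV // => h.
by rewrite /qint; field; rewrite q_neq0 /= h.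
Qed.

Lemma loop_value_inj : injective (fun L : nat => (- qint q 2) ^+ L).
Proof.
have inj L L' : (L < L')%N -> (- qint q 2) ^+ L != (- qint q 2) ^+ L'.
  move=> h; have l0 : (- qint q 2) ^+ L != 0.
    by rewrite expf_neq0 // oppr_eq0 qint_neq0.
  rewrite -(subnKC (ltnW h)) exprD -{1}[_ ^+ L]mulr1 (inj_eq (mulfI l0)) eq_sym.
  have k0 : (0 < L' - L)%N by rewrite subn_gt0.
  apply: contra (q2_not_root k0) => /eqP E.
  by rewrite -mul_q_loop exprMn E mulr1.
move=> L L' E; case: (ltngtP L L') => // h; have := inj _ _ h; by rewrite E eqxx.
Qed.

End NotRootOfUnity.

Section FunctionField.
Variable R : realType.
Local Notation q := (qvar R).

Lemma tofrac_injective : injective (@tofrac {poly R[i]}).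
Proof. by move=> x y /eqP; rewrite tofrac_eq => /eqP. Qed.

Lemma qvar_neq0 : q != 0.
Proof. by rewrite /qvar tofrac_eq0 polyX_eq0. Qed.

(** Evaluate the polynomials at 0; the same works for [qvar2_not_root]. *)
Lemma qvar_not_root m : (0 < m)%N -> q ^+ m != 1.
Proof.
move=> m0; apply/eqP; rewrite /qvar -tofracXn -tofrac1 => /tofrac_injective.
move=> /(congr1 (fun p : {poly R[i]} => p.[0])).
rewrite hornerXn hornerC expr0n; case: m m0 => // m _ /eqP.
by rewrite eq_sym oner_eq0.
Qed.

Lemma qvar2_not_root k : (0 < k)%N -> (- (q ^+ 2 + 1)) ^+ k != q ^+ k.
Proof.
move=> k0; apply/eqP.
rewrite /qvar -tofracXn -tofrac1 -tofracD -tofracN -!tofracXn => /tofrac_injective.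
move/(congr1 (fun p : {poly R[i]} => p.[0])).
rewrite hornerXn horner_exp hornerN hornerD hornerXn hornerC !expr0n (gtn_eqF k0) /= add0r.
by move/eqP; rewrite expf_eq0 k0 oppr_eq0 oner_eq0.
Qed.

End FunctionField.

Theorem proposition3p13 (R : realType)
    (Q : forall n : nat, TLD (qvar R) n)
    (b : forall n : nat, diagram n.+1 -> TLD (qvar R) n)
    (coef : forall n : nat, diagram n.+1 -> Cq R)
    (hQ : is_projection Q)
    (hb : is_diagram_basis b)
    (hcoef : is_coef Q b coef)
    (n : nat) (C : pairing n.+2) (hC : connectivity C) :
  a_coef (qvar R) coef C =
  \sum_(i < n.+2 | innermost C i)
     qint (qvar R) i.+1 / qint (qvar R) n.+2 *
     a_coef (qvar R) coef (remove_cap C i).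
Proof.
have q0 := qvar_neq0 R; have q1 := @qvar_not_root R.
exact: (a_coef_rec (qint_neq0 q0 q1) q0 (q_sub_inv q0 q1)
  (loop_value_inj q0 q1 (@qvar2_not_root R)) hQ hb hcoef hC).
Qed.
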